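(* Let $\mathfrak{g}=\mathfrak{g}_0\oplus\mathfrak{g}_1$ be a finite dimensional Lie superalgebra over $\mathbb{C}$, let $q$ be a homogeneous prime ideal of $S(\mathfrak{g}_0)$, let $F_q,\,C_q,\,k(q),\,\delta_q$ be as in the context, and let $L$ be a simple $C_q$-module. Write $C_q\cong M_{2^a}(D)$ with $D$ a division algebra. (a) If $k(q)$ is even then $C_q$ is a central simple algebra over $F_q$ and $\dim_{F_q}L\ge 2^{k(q)/2}$. Equality holds if and only if $D=F_q$. (b) If $k(q)$ is odd then $C_q$ is a central simple algebra over $F_q(\sqrt{\delta_q})$ and $\dim_{F_q}L\ge 2^{(k(q)+1)/2}$. Equality holds if and only if $D=F_q(\sqrt{\delta_q})$.
   Context: Homogeneous means homogeneous for the usual grading $S(\mathfrak{g}_0)=\bigoplus_{n\ge0}S^n(\mathfrak{g}_0)$. $F_q=\mathrm{Fract}(S(\mathfrak{g}_0)/q)$. The Lie bracket $\mathfrak{g}_1\times\mathfrak{g}_1\to\mathfrak{g}_0\subset S(\mathfrak{g}_0)$, reduced modulo $q$, extends to a symmetric $F_q$-bilinear form on $\mathfrak{g}_1\otimes_{\mathbb{C}}F_q$. $B_q$ is the induced nondegenerate form on the quotient of $\mathfrak{g}_1\otimes F_q$ by the radical of this form; $k(q)$ is the rank of $B_q$; $\delta_q$ is the determinant of $B_q$ (with respect to a basis of the quotient; well defined up to nonzero squares in $F_q$). $C_q$ is the Clifford algebra of $B_q$ over $F_q$, i.e. the $F_q$-algebra generated by the quotient space with relations $uv+vu=B_q(u,v)$;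 $\dim_{F_q}C_q=2^{k(q)}$. *)

(* Defs.v *)
From HB Require Import structures.
From mathcomp Require Import all_boot all_order all_algebra.
From mathcomp Require Import fraction ring_quotient falgebra fieldext.
From mathcomp Require Import boolp reals complex.
From mathcomp.multinomials Require Import monalg mpoly.

Set Implicit Arguments.
Unset Strict Implicit.
Unset Printing Implicit Defensive.

Import GRing.Theory.
Local Open Scope ring_scope.
Local Open Scope quotient_scope.

(* The Z/2-grading is indexed by bool: part false is the even part g_0 and
   part true the odd part g_1. *)
Record lieSuperalgebra (K : fieldType) := LieSuperalgebra {
  lsa_sort :> vectType K;
  lsa_part : bool -> {vspace lsa_sort};
  lsa_bracket : lsa_sort -> lsa_sort -> lsa_sort;
  lsa_part_full : (lsa_part false + lsa_part true)%VS = fullv;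
  lsa_part_direct : (lsa_part false :&: lsa_part true)%VS = 0%VS;
  lsa_linear_l : forall y, linear (lsa_bracket^~ y);
  lsa_linear_r : forall x, linear (lsa_bracket x);
  lsa_graded : forall i j x y, x \in lsa_part i -> y \in lsa_part j ->
    lsa_bracket x y \in lsa_part (i (+) j);
  lsa_skew : forall i j x y, x \in lsa_part i -> y \in lsa_part j ->
    lsa_bracket x y = - ((-1) ^+ (i && j) *: lsa_bracket y x);
  lsa_jacobi : forall i j x y z, x \in lsa_part i -> y \in lsa_part j ->
    lsa_bracket x (lsa_bracket y z) =
      lsa_bracket (lsa_bracket x y) z
      + (-1) ^+ (i && j) *: lsa_bracket y (lsa_bracket x z)
}.

Notation even_part g := (lsa_part g false).
Notation odd_part g := (lsa_part g true).

(* The symmetric algebra of the even part, as polynomials in the chosen basis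
   [vbasis (even_part g)]; [sym_inj] is the inclusion in degree 1.
   The notation {mpoly K[n]} is avoided: monalg also defines it, with another
   meaning. *)
Definition sym_alg (K : fieldType) (g : lieSuperalgebra K) : comNzRingType :=
  mpoly (\dim (even_part g)) K.

Definition sym_inj (K : fieldType) (g : lieSuperalgebra K) (x : g)
    : sym_alg g :=
  \sum_i coord (vbasis (even_part g)) i x *: 'X_i.

Definition homogeneous_ideal (n : nat) (K : fieldType)
    (I : mpoly n K -> bool) : Prop :=
  forall p d, I p -> I (pihomog mdeg d p).

Definition quot_domain (R : comNzRingType) (q : prime_idealr R) : Type :=
  {ideal_quot q}.

Section QuotDomain.
Variables (R : comNzRingType) (q : prime_idealr R).
Notation D := (quot_domain q).

HB.instance Definition _ := GRing.ComNzRing.on D.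

Definition quot_proj (x : R) : D := \pi_{ideal_quot q} x.

Fact quot_proj_zmod_morphism : zmod_morphism quot_proj.
Proof. by move=> x y; rewrite /quot_proj rmorphB. Qed.
Fact quot_proj_monoid_morphism : monoid_morphism quot_proj.
Proof. by split=> [|x y]; rewrite /quot_proj ?rmorph1 ?rmorphM. Qed.
HB.instance Definition _ := GRing.isZmodMorphism.Build R D quot_proj
  quot_proj_zmod_morphism.
HB.instance Definition _ := GRing.isMonoidMorphism.Build R D quot_proj
  quot_proj_monoid_morphism.

Lemma quot_proj_eq0 x : (quot_proj x == 0) = (x \in q).
Proof. by rewrite -[in RHS](subr0 x) Quotient.idealrBE rmorph0. Qed.

Definition quot_unit : {pred D} := [pred x | `[< exists y, y * x = 1 >]].
Definition quot_inv (x : D) : D :=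
  if pselect (exists y, y * x = 1) is left h then projT1 (cid h) else x.

Fact quot_mulVx : {in quot_unit, left_inverse 1 quot_inv *%R}.
Proof.
move=> x /asboolP ux; rewrite /quot_inv; case: pselect => // h.
exact: projT2 (cid h).
Qed.

Fact quot_unitPl (x y : D) : y * x = 1 -> quot_unit x.
Proof. by move=> xy; apply/asboolP; exists y. Qed.

Fact quot_inv_out : {in [predC quot_unit], quot_inv =1 id}.
Proof.
by move=> x /asboolPn nux; rewrite /quot_inv; case: pselect.
Qed.

HB.instance Definition _ := GRing.ComNzRing_hasMulInverse.Build D
  quot_mulVx quot_unitPl quot_inv_out.

Fact quot_integral : GRing.integral_domain_axiom D.
Proof. by move=> x y; apply: Quotient.rquot_IdomainAxiom. Qed.

HB.instance Definition _ := GRing.ComUnitRing_isIntegral.Build D quot_integral.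

End QuotDomain.

(* The bilinear form with Gram matrix G on F^m and the quotient of F^m by its
   radical. *)
Section RadicalQuotient.
Variables (F : fieldType) (m : nat) (G : 'M[F]_m).

Definition mxform (u v : 'rV[F]_m) : F := (u *m G *m v^T) 0 0.

Definition radical : {pred 'rV[F]_m} :=
  [pred u | `[< forall v, mxform u v = 0 >]].

Lemma radicalE u : (u \in radical) = (u *m G == 0).
Proof.
apply/asboolP/eqP => [u0|u0 v]; last by rewrite /mxform u0 mul0mx mxE.
apply/rowP=> j; have := u0 (delta_mx 0 j); rewrite /mxform trmx_delta.
by rewrite -colE !mxE.
Qed.

Fact radical_zmod_closed : zmod_closed radical.
Proof.
split=> [|u v]; rewrite !radicalE ?mul0mx // => /eqP u0 /eqP v0.
by rewrite mulmxBl u0 v0 subrr.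
Qed.
HB.instance Definition _ := GRing.isZmodClosed.Build _ radical
  radical_zmod_closed.

Definition radical_quot : Type := {ideal_quot radical}.
HB.instance Definition _ := GRing.Zmodule.on radical_quot.

Definition radical_proj (u : 'rV[F]_m) : radical_quot :=
  \pi_{ideal_quot radical} u.
Definition radical_repr (x : radical_quot) : 'rV[F]_m :=
  repr (x : {ideal_quot radical}).

Lemma radical_reprK : cancel radical_repr radical_proj.
Proof. exact: reprK. Qed.

Lemma radical_proj_eq u v :
  (radical_proj u = radical_proj v) <-> (u *m G = v *m G).
Proof.
rewrite /radical_proj; split.
  move/eqP; rewrite -Quotient.idealrBE radicalE mulmxBl subr_eq0.
  by move/eqP.
by move=> uv; apply/eqP; rewrite -Quotient.idealrBE radicalE mulmxBl uv subrr.
Qed.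

Lemma radical_projB : {morph radical_proj : u v / u - v}.
Proof. by move=> u v; rewrite /radical_proj raddfB. Qed.

Lemma radical_projD : {morph radical_proj : u v / u + v}.
Proof. by move=> u v; rewrite /radical_proj !piE. Qed.

Lemma mulmx_radical_repr u : radical_repr (radical_proj u) *m G = u *m G.
Proof. by apply/radical_proj_eq; rewrite radical_reprK. Qed.

Definition radical_scale (a : F) (x : radical_quot) : radical_quot :=
  radical_proj (a *: radical_repr x).

Lemma radical_projZ a u :
  radical_proj (a *: u) = radical_scale a (radical_proj u).
Proof. by apply/radical_proj_eq; rewrite -!scalemxAl mulmx_radical_repr. Qed.

Fact radical_scalerA a b x :
  radical_scale a (radical_scale b x) = radical_scale (a * b) x.
Proof. by rewrite -[x]radical_reprK -!radical_projZ scalerA. Qed.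
Fact radical_scale1r : left_id 1 radical_scale.
Proof. by move=> x; rewrite -[x]radical_reprK -radical_projZ scale1r. Qed.
Fact radical_scalerDr : right_distributive radical_scale +%R.
Proof.
move=> a x y; rewrite -[x]radical_reprK -[y]radical_reprK.
by rewrite -radical_projD -!radical_projZ scalerDr radical_projD.
Qed.
Fact radical_scalerDl x : {morph radical_scale^~ x : a b / a + b}.
Proof.
move=> a b; rewrite -[x]radical_reprK -!radical_projZ.
by rewrite scalerDl radical_projD.
Qed.
HB.instance Definition _ := GRing.Zmodule_isLmodule.Build F radical_quot
  radical_scalerA radical_scale1r radical_scalerDr radical_scalerDl.

Fact radical_proj_linear : linear radical_proj.
Proof. by move=> a u v; rewrite radical_projD radical_projZ. Qed.
HB.instance Definition _ := GRing.isLinear.Build F 'rV[F]_m radical_quot _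
  radical_proj radical_proj_linear.

Definition radical_coord (x : radical_quot) : 'rV[F]_(\rank G) :=
  radical_repr x *m col_base G.

Let mulmxG (w : 'rV[F]_m) : w *m G = w *m col_base G *m row_base G.
Proof. by rewrite -{1}(mulmx_base G) mulmxA. Qed.

Lemma radical_coord_proj u : radical_coord (radical_proj u) = u *m col_base G.
Proof.
apply: (row_free_inj (row_base_free G)).
by rewrite -!mulmxG mulmx_radical_repr.
Qed.

Fact radical_quot_vect : vector_axiom_def (\rank G) radical_quot.
Proof.
exists radical_coord.
  move=> a x y; rewrite -[x]radical_reprK -[y]radical_reprK.
  rewrite -linearP !radical_coord_proj.
  by rewrite mulmxDl scalemxAl.
exists (fun v => radical_proj (v *m pinvmx (col_base G))) => [x|v].
  rewrite -[x in RHS]radical_reprK; apply/radical_proj_eq.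
  by rewrite !mulmxG mulmxKpV // submxMl.
rewrite radical_coord_proj mulmxKpV //.
by apply: submx_full; apply: col_base_full.
Qed.
HB.instance Definition _ := Lmodule_hasFinDim.Build F radical_quot
  radical_quot_vect.

(* For symmetric G this is the form induced by [mxform] on the quotient, see
   [radical_form_proj]. *)
Definition radical_form (x y : radical_quot) : F :=
  mxform (radical_repr x) (radical_repr y).

Hypothesis symG : G^T = G.

Lemma radical_form_proj u v :
  radical_form (radical_proj u) (radical_proj v) = mxform u v.
Proof.
rewrite /radical_form /mxform mulmx_radical_repr -!mulmxA; congr ((_ *m _) 0 0).
by apply: trmx_inj; rewrite !trmx_mul !trmxK symG mulmx_radical_repr.
Qed.

Lemma mxformC u v : mxform u v = mxform v u.
Proof.
rewrite /mxform; have -> : v *m G *m u^T = (u *m G *m v^T)^T.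
  by rewrite !trmx_mul trmxK symG mulmxA.
by rewrite [RHS]mxE.
Qed.

Lemma radical_formC x y : radical_form x y = radical_form y x.
Proof. exact: mxformC. Qed.

Lemma radical_form_linear x : linear (radical_form x : _ -> F^o).
Proof.
move=> a y z; rewrite -[x]radical_reprK -[y]radical_reprK -[z]radical_reprK.
rewrite -linearP !radical_form_proj /mxform.
by rewrite linearP mulmxDr -scalemxAr !mxE.
Qed.

End RadicalQuotient.

Definition two_sided_ideal (A : pzRingType) (I : A -> Prop) : Prop :=
  [/\ I 0, forall x y, I x -> I y -> I (x - y)
    & forall a x, I x -> I (a * x) /\ I (x * a)].

(* The F-algebra generated by the space V subject to uv + vu = B(u, v): the
   quotient of the free algebra on the set V by the two-sided ideal generated by
   these relations and by the linearity relations. *)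
Section Clifford.
Variables (F : fieldType) (V : lmodType F) (B : V -> V -> F).
Notation T := {malg F[{fmonom V}]}.

Definition free_gen (v : V) : T := mkmalgU (fmu v) 1.

Inductive clifford_rel : T -> Prop :=
  | Clifford_add u v :
      clifford_rel (free_gen (u + v) - (free_gen u + free_gen v))
  | Clifford_scale c v :
      clifford_rel (free_gen (c *: v) - c *: free_gen v)
  | Clifford_anticomm u v :
      clifford_rel (free_gen u * free_gen v + free_gen v * free_gen u
                    - (B u v)%:A).

Definition clifford_ideal : {pred T} := [pred x |
  `[< forall I : T -> Prop, two_sided_ideal I ->
        (forall r, clifford_rel r -> I r) -> I x >]].

Lemma clifford_ideal_rel r : clifford_rel r -> r \in clifford_ideal.
Proof. by move=> rr; apply/asboolP=> I _; apply. Qed.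

Lemma clifford_idealM a x : x \in clifford_ideal ->
  (a * x \in clifford_ideal) * (x * a \in clifford_ideal).
Proof.
move/asboolP=> xI; split; apply/asboolP=> I idI rI; have [_ _ idM] := idI;
  by have [] := idM a x (xI I idI rI).
Qed.

Fact clifford_ideal_zmod_closed : zmod_closed clifford_ideal.
Proof.
split=> [|x y /asboolP xI /asboolP yI]; apply/asboolP=> I idI rI.
  by have [] := idI.
by have [_ idB _] := idI; apply: idB; [apply: xI | apply: yI].
Qed.
HB.instance Definition _ := GRing.isZmodClosed.Build _ clifford_ideal
  clifford_ideal_zmod_closed.

Definition clifford : Type := {ideal_quot clifford_ideal}.
HB.instance Definition _ := GRing.Zmodule.on clifford.

Definition clifford_proj (x : T) : clifford := \pi_{ideal_quot clifford_ideal} x.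
Definition clifford_repr (x : clifford) : T :=
  repr (x : {ideal_quot clifford_ideal}).

Lemma clifford_reprK : cancel clifford_repr clifford_proj.
Proof. exact: reprK. Qed.

Lemma clifford_proj_eq x y :
  (clifford_proj x = clifford_proj y) <-> (x - y \in clifford_ideal).
Proof.
by rewrite Quotient.idealrBE; split=> [/eqP|/eqP].
Qed.

Lemma clifford_projB : {morph clifford_proj : x y / x - y}.
Proof. by move=> x y; rewrite /clifford_proj raddfB. Qed.

Lemma clifford_proj0 : clifford_proj 0 = 0.
Proof. by have := clifford_projB 0 0; rewrite !subrr. Qed.

Lemma clifford_projD : {morph clifford_proj : x y / x + y}.
Proof. by move=> x y; rewrite /clifford_proj !piE. Qed.

Lemma clifford_projK x : clifford_repr (clifford_proj x) - x \in clifford_ideal.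
Proof. by apply/clifford_proj_eq; rewrite clifford_reprK. Qed.

Definition clifford_mul (x y : clifford) : clifford :=
  clifford_proj (clifford_repr x * clifford_repr y).

Definition clifford_scale (a : F) (x : clifford) : clifford :=
  clifford_proj (a *: clifford_repr x).

Lemma clifford_projM x y :
  clifford_proj (x * y) = clifford_mul (clifford_proj x) (clifford_proj y).
Proof.
apply/esym/clifford_proj_eq.
set x' := clifford_repr _; set y' := clifford_repr _.
have -> : x' * y' - x * y = (x' - x) * y' + x * (y' - y).
  by rewrite mulrBl mulrBr addrA subrK.
by rewrite rpredD ?(clifford_idealM _ (clifford_projK _)).
Qed.

Lemma clifford_projZ a x :
  clifford_proj (a *: x) = clifford_scale a (clifford_proj x).
Proof.
apply/esym/clifford_proj_eq; rewrite -scalerBr -mul_malgC.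
by rewrite (clifford_idealM _ (clifford_projK _)).
Qed.

Fact clifford_mulA : associative clifford_mul.
Proof.
move=> x y z.
rewrite -[x]clifford_reprK -[y]clifford_reprK -[z]clifford_reprK.
by rewrite -!clifford_projM mulrA.
Qed.
Fact clifford_mul1x : left_id (clifford_proj 1) clifford_mul.
Proof. by move=> x; rewrite -[x]clifford_reprK -clifford_projM mul1r. Qed.
Fact clifford_mulx1 : right_id (clifford_proj 1) clifford_mul.
Proof. by move=> x; rewrite -[x]clifford_reprK -clifford_projM mulr1. Qed.
Fact clifford_mulDl : left_distributive clifford_mul +%R.
Proof.
move=> x y z.
rewrite -[x]clifford_reprK -[y]clifford_reprK -[z]clifford_reprK.
by rewrite -clifford_projD -!clifford_projM mulrDl clifford_projD.
Qed.
Fact clifford_mulDr : right_distributive clifford_mul +%R.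
Proof.
move=> x y z.
rewrite -[x]clifford_reprK -[y]clifford_reprK -[z]clifford_reprK.
by rewrite -clifford_projD -!clifford_projM mulrDr clifford_projD.
Qed.
HB.instance Definition _ := GRing.Zmodule_isPzRing.Build clifford
  clifford_mulA clifford_mul1x clifford_mulx1 clifford_mulDl clifford_mulDr.

Fact clifford_scalerA a b x :
  clifford_scale a (clifford_scale b x) = clifford_scale (a * b) x.
Proof. by rewrite -[x]clifford_reprK -!clifford_projZ scalerA. Qed.
Fact clifford_scale1r : left_id 1 clifford_scale.
Proof. by move=> x; rewrite -[x]clifford_reprK -clifford_projZ scale1r. Qed.
Fact clifford_scalerDr : right_distributive clifford_scale +%R.
Proof.
move=> a x y; rewrite -[x]clifford_reprK -[y]clifford_reprK.
by rewrite -clifford_projD -!clifford_projZ scalerDr clifford_projD.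
Qed.
Fact clifford_scalerDl x : {morph clifford_scale^~ x : a b / a + b}.
Proof.
move=> a b; rewrite -[x]clifford_reprK -!clifford_projZ.
by rewrite scalerDl clifford_projD.
Qed.
HB.instance Definition _ := GRing.Zmodule_isLmodule.Build F clifford
  clifford_scalerA clifford_scale1r clifford_scalerDr clifford_scalerDl.

Lemma clifford_scalerAl (a : F) (x y : clifford) : a *: (x * y) = (a *: x) * y.
Proof.
rewrite -[x]clifford_reprK -[y]clifford_reprK.
rewrite -[LHS]/(clifford_scale a (clifford_mul _ _)).
rewrite -[RHS]/(clifford_mul (clifford_scale a _) _).
by rewrite -clifford_projM -!clifford_projZ -clifford_projM scalerAl.
Qed.

Lemma malg_scalerAr (a : F) (x y : T) : a *: (x * y) = x * (a *: y).
Proof.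
apply/malgP=> k; rewrite monalg.mcoeffZ.
rewrite (monalg.mcoeffMlw _ (finmap.fsubset_refl _) (monalg.msuppZ_le a y)).
rewrite monalg.mcoeffMl mulr_sumr; apply: eq_bigr => k1 _.
rewrite mulr_sumr; apply: eq_bigr => k2 _.
by rewrite monalg.mcoeffZ mulrnAr mulrCA.
Qed.

Lemma clifford_scalerAr (a : F) (x y : clifford) : a *: (x * y) = x * (a *: y).
Proof.
rewrite -[x]clifford_reprK -[y]clifford_reprK.
rewrite -[LHS]/(clifford_scale a (clifford_mul _ _)).
rewrite -[RHS]/(clifford_mul _ (clifford_scale a _)).
by rewrite -clifford_projM -!clifford_projZ -clifford_projM malg_scalerAr.
Qed.

(* Evaluation of the free algebra, used to show that the ideal is proper. *)
Section Eval.
Variables (A : algType F) (f : V -> A).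

Definition word_eval (m : {fmonom V}) : A := \prod_(v <- (m : seq V)) f v.

Fact word_eval_mmorphism : mmorphism word_eval.
Proof.
split=> [m1 m2|]; first by rewrite /word_eval fmM big_cat.
by rewrite /word_eval fm1 big_nil.
Qed.
HB.instance Definition _ := isMultiplicative.Build _ _ word_eval
  word_eval_mmorphism.

Definition free_eval : T -> A := monalg.mmap (in_alg A) word_eval.

Lemma free_eval_gen v : free_eval (free_gen v) = f v.
Proof.
by rewrite /free_eval monalg.mmapU /= scale1r mul1r /word_eval fmU big_seq1.
Qed.

Lemma free_evalM : {morph free_eval : x y / x * y}.
Proof.
have [|mM _] := @monalg.commr_mmap_is_multiplicative _ _ _ (in_alg A) word_eval.
  by move=> g m m'; rewrite /GRing.comm /= -scalerAl -scalerAr mul1r mulr1.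
exact: mM.
Qed.

Lemma free_eval1 : free_eval 1 = 1.
Proof. exact: monalg.mmap1. Qed.

Lemma free_evalB : {morph free_eval : x y / x - y}.
Proof. exact: monalg.mmapB. Qed.

Lemma free_evalD : {morph free_eval : x y / x + y}.
Proof. exact: monalg.mmapD. Qed.

Lemma free_evalZ c x : free_eval (c *: x) = c *: free_eval x.
Proof. by rewrite /free_eval monalg.mmapZ /= -scalerAl mul1r. Qed.

Hypotheses (linf : linear f)
  (anticommf : forall u v, f u * f v + f v * f u = (B u v)%:A).

Lemma free_eval_ideal x : x \in clifford_ideal -> free_eval x = 0.
Proof.
move=> /asboolP/(_ (fun y => free_eval y = 0)); apply=> [|r].
  split=> [|y z y0 z0|a y y0]; first exact: monalg.mmap0.
    by rewrite free_evalB y0 z0 subr0.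
  by rewrite !free_evalM y0 mulr0 mul0r.
pose lf := GRing.isLinear.Build F V A _ f linf.
pose f' : {linear V -> A} := HB.pack f lf.
have fD u v : f (u + v) = f u + f v := linearD f' u v.
have fZ c v : f (c *: v) = c *: f v := linearZ_LR f' c v.
case=> [u v|c v|u v]; rewrite free_evalB.
- by rewrite free_evalD !free_eval_gen fD subrr.
- by rewrite free_evalZ !free_eval_gen fZ subrr.
rewrite free_evalD !free_evalM !free_eval_gen free_evalZ free_eval1 anticommf.
by rewrite subrr.
Qed.

End Eval.

End Clifford.

(* Creation and annihilation matrices satisfying the canonical
   anticommutation relations. *)
Lemma fock_matrices (F : fieldType) (n : nat) :
  exists (N : nat) (c a : nat -> 'M[F]_N.+1),
    forall i j, (i < n)%N -> (j < n)%N ->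
      [/\ c i * c j + c j * c i = 0, a i * a j + a j * a i = 0
        & a i * c j + c j * a i = (i == j)%:R].
Proof.
elim: n => [|n [N [c [a ca]]]]; first by exists 0%N, (fun=> 0), (fun=> 0).
pose bl (X Y Z W : 'M[F]_N.+1) : 'M[F]_((N + N.+1).+1) := block_mx X Y Z W.
exists (N + N.+1)%N.
exists (fun i => if i is k.+1 then bl (c k) 0 0 (- c k) else bl 0 1 0 0).
exists (fun i => if i is k.+1 then bl (a k) 0 0 (- a k) else bl 0 0 1 0).
have blM X Y Z W X' Y' Z' W' : bl X Y Z W * bl X' Y' Z' W' =
    bl (X * X' + Y * Z') (X * Y' + Y * W') (Z * X' + W * Z') (Z * Y' + W * W').
  exact: (@mulmx_block F N.+1 N.+1 N.+1 N.+1 N.+1 N.+1).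
have blD X Y Z W X' Y' Z' W' : bl X Y Z W + bl X' Y' Z' W' =
    bl (X + X') (Y + Y') (Z + Z') (W + W').
  exact: (@add_block_mx F N.+1 N.+1 N.+1 N.+1).
have bl0 : bl 0 0 0 0 = 0 by rewrite /bl block_mx0.
have bl1 : bl 1 0 0 1 = 1 by rewrite /bl -scalar_mx_block.
case=> [|i] [|j] ltin ltjn; rewrite !blM !blD
  !(mulr0, mul0r, mulr1, mul1r, mulNr, mulrN, opprK, addr0, add0r, oppr0);
  rewrite ?(subrr, addNr, bl0, bl1); split=> //.
all: have [cc aa ac] := ca i j ltin ltjn; rewrite ?cc ?aa ?ac ?bl0 //.
by rewrite eqSS; case: eqP; rewrite ?bl0 ?bl1.
Qed.

Lemma anticomm_sum (F : fieldType) (A : algType F) (n : nat)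
    (s t : 'I_n -> F) (x y : 'I_n -> A) :
  (\sum_i s i *: x i) * (\sum_j t j *: y j)
  + (\sum_j t j *: y j) * (\sum_i s i *: x i) =
  \sum_i \sum_j (s i * t j) *: (x i * y j + y j * x i).
Proof.
rewrite mulr_suml mulr_sumr -big_split /=; apply: eq_bigr => i _.
rewrite mulr_sumr mulr_suml -big_split /=; apply: eq_bigr => j _.
rewrite -!scalerAl -!scalerAr !scalerA scalerDr.
by congr (_ + _); rewrite mulrC.
Qed.

Lemma clifford_nontrivial (F : fieldType) (V : vectType F) (B : V -> V -> F) :
    (2%:R : F) != 0 -> (forall u v, B u v = B v u) ->
    (forall u, linear (B u : V -> F^o)) ->
  (1 : clifford B) != 0.
Proof.
move=> F2 symB linB; pose n := \dim {:V}; pose e := vbasis {:V}.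
pose x (v : V) (i : 'I_n) : F := coord e i v.
have vE v : v = \sum_i x v i *: e`_i by apply: coord_vbasis; rewrite memvf.
have [N [c [a ca]]] := fock_matrices F n.
pose b (v : V) (i : 'I_n) : F := B v e`_i / 2%:R.
pose P v : 'M[F]_N.+1 := \sum_i x v i *: c i.
pose Q v : 'M[F]_N.+1 := \sum_i b v i *: a i.
pose f v := P v + Q v.
have linB' u s v w : B u (s *: v + w) = s * B u v + B u w by apply: linB.
have xb u v : \sum_i x u i * b v i = B u v / 2%:R.
  pose lB := GRing.isLinear.Build F V F^o _ (B v) (linB v).
  pose B' : {linear V -> F^o} := HB.pack (B v : V -> F^o) lB.
  have -> : B u v = \sum_i x u i * B v e`_i.
    rewrite symB {1}(vE u) -[LHS]/(B' _) linear_sum; apply: eq_bigr => i _.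
    exact: linearZ_LR.
  by rewrite mulr_suml; apply: eq_bigr => i _; rewrite mulrA.
have PP u v : P u * P v + P v * P u = 0.
  rewrite anticomm_sum big1 // => i _; rewrite big1 // => j _.
  by have [-> _ _] := ca i j (ltn_ord i) (ltn_ord j); rewrite scaler0.
have QQ u v : Q u * Q v + Q v * Q u = 0.
  rewrite anticomm_sum big1 // => i _; rewrite big1 // => j _.
  by have [_ -> _] := ca i j (ltn_ord i) (ltn_ord j); rewrite scaler0.
have QP u v : Q u * P v + P v * Q u = (B u v / 2%:R)%:A.
  rewrite anticomm_sum symB -xb scaler_suml; apply: eq_bigr => i _.
  rewrite (bigD1 i) //= big1 ?addr0 => [|j ij].
    by have [_ _ ->] := ca i i (ltn_ord i) (ltn_ord i); rewrite eqxx mulrC.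
  have [_ _ ->] := ca i j (ltn_ord i) (ltn_ord j).
  by rewrite val_eqE eq_sym (negPf ij) scaler0.
have linf : linear f.
  move=> s u v; rewrite /f scalerDr addrACA; congr (_ + _).
    rewrite scaler_sumr -big_split /=; apply: eq_bigr => i _.
    by rewrite scalerA -scalerDl /x linearP.
  rewrite scaler_sumr -big_split /=; apply: eq_bigr => i _.
  rewrite scalerA -scalerDl; congr (_ *: _).
  by rewrite /b symB linB' mulrDl -mulrA ![B e`_i _]symB.
have acf u v : f u * f v + f v * f u = (B u v)%:A.
  rewrite /f !mulrDl !mulrDr addrACA [X in X + _]addrACA [X in _ + X]addrACA.
  rewrite PP QQ add0r addr0 addrC [X in _ + X]addrC addrACA QP QP -scalerDl.
  congr (_ *: _); rewrite -mulrDl [B v u]symB -mulr2n -[_ *+ 2]mulr_natr.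
  by rewrite mulfK.
apply/negP=> /eqP eq10.
have /clifford_proj_eq : clifford_proj B 1 = clifford_proj B 0.
  by rewrite clifford_proj0; exact: eq10.
rewrite subr0 => /(free_eval_ideal linf acf).
by move/eqP; rewrite free_eval1 oner_eq0.
Qed.

Section SuperalgebraForm.
Variables (R : realType) (g : lieSuperalgebra R[i]).
Variable q : prime_idealr (sym_alg g).

Definition frac_q : fieldType := {fraction (quot_domain q)}.

Definition to_frac_q (s : sym_alg g) : frac_q := tofrac (quot_proj q s).

HB.instance Definition _ := GRing.RMorphism.copy to_frac_q
  (@tofrac (quot_domain q) \o quot_proj q).

Lemma to_frac_q_eq0 s : (to_frac_q s == 0) = (s \in q).
Proof. by rewrite tofrac_eq0 quot_proj_eq0. Qed.

Fact frac_q_two_neq0 : (2%:R : frac_q) != 0.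
Proof.
rewrite -(rmorph_nat to_frac_q) to_frac_q_eq0.
apply/negP=> /(idealMr ((2%:R^-1)%:MP)); rewrite -mpolyC_nat -mpolyCM.
by rewrite mulVf ?Num.Theory.pnatr_eq0 // mpolyC1 idealr1.
Qed.

(* g_1 (x) F_q is identified with row vectors through the chosen basis
   [vbasis (odd_part g)]; this is the Gram matrix of the bracket there. *)
Definition bracket_mx : 'M[frac_q]_(\dim (odd_part g)) := \matrix_(i, j)
  to_frac_q (sym_inj (lsa_bracket (vbasis (odd_part g))`_i
                                  (vbasis (odd_part g))`_j)).

Lemma bracket_mx_sym : bracket_mx^T = bracket_mx.
Proof.
apply/matrixP=> i j; rewrite !mxE; congr (to_frac_q (sym_inj _)).
have odd_e (k : 'I_(\dim (odd_part g))) : (vbasis (odd_part g))`_k \in odd_part g.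
  by apply: vbasis_mem; apply: mem_nth; rewrite size_tuple.
by rewrite (lsa_skew (odd_e j) (odd_e i)) scaleN1r opprK.
Qed.

Definition odd_quot : vectType frac_q := radical_quot bracket_mx.
Definition form_q : odd_quot -> odd_quot -> frac_q :=
  @radical_form _ _ bracket_mx.

Definition gram n (e : n.-tuple odd_quot) : 'M[frac_q]_n :=
  \matrix_(i, j) form_q e`_i e`_j.

Definition rank_q : nat := \rank (gram (vbasis {:odd_quot})).

Definition clifford_q : Type := clifford form_q.
HB.instance Definition _ := GRing.PzRing.on clifford_q.
HB.instance Definition _ := GRing.Lmodule.on clifford_q.

Fact clifford_q_oner_neq0 : (1 : clifford_q) != 0.
Proof.
apply: clifford_nontrivial; first exact: frac_q_two_neq0.
  exact/radical_formC/bracket_mx_sym.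
exact/radical_form_linear/bracket_mx_sym.
Qed.
HB.instance Definition _ := GRing.PzSemiRing_isNonZero.Build clifford_q
  clifford_q_oner_neq0.
HB.instance Definition _ := GRing.Lmodule_isLalgebra.Build frac_q clifford_q
  (@clifford_scalerAl _ _ form_q).
HB.instance Definition _ := GRing.Lalgebra_isAlgebra.Build frac_q clifford_q
  (@clifford_scalerAr _ _ form_q).

End SuperalgebraForm.

(* Scalars of an A-module restricted along a ring morphism K -> A. *)
Definition restrict_scalars (K A : pzRingType) (f : {rmorphism K -> A})
  (M : lmodType A) : Type := M.

Section Restrict.
Variables (K A : pzRingType) (f : {rmorphism K -> A}) (M : lmodType A).
HB.instance Definition _ := GRing.Zmodule.on (restrict_scalars f M).

Definition rscale (c : K) (x : restrict_scalars f M) : restrict_scalars f M :=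
  f c *: (x : M).

Fact rscalerA a b x :
  rscale a (rscale b x) = rscale (a * b) x.
Proof. by rewrite /rscale scalerA rmorphM. Qed.
Fact rscale1r : left_id 1 rscale.
Proof. by move=> x; rewrite /rscale rmorph1 scale1r. Qed.
Fact rscalerDr : right_distributive rscale +%R.
Proof. by move=> a x y; rewrite /rscale scalerDr. Qed.
Fact rscalerDl x : {morph rscale^~ x : a b / a + b}.
Proof. by move=> a b; rewrite /rscale rmorphD scalerDl. Qed.
HB.instance Definition _ := GRing.Zmodule_isLmodule.Build K (restrict_scalars f M)
  rscalerA rscale1r rscalerDr rscalerDl.
End Restrict.

Definition has_dim (K : fieldType) (V : lmodType K) (n : nat) : Prop :=
  exists e : 'I_n -> V,
    forall v, exists! c : 'rV[K]_n, v = \sum_i c 0 i *: e i.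

Definition simple_module (A : pzRingType) (M : lmodType A) : Prop :=
  (exists x : M, x <> 0) /\
  forall N : M -> Prop,
    N 0 -> (forall x y, N x -> N y -> N (x + y)) ->
    (forall a x, N x -> N (a *: x)) ->
    (forall x, N x -> x = 0) \/ (forall x, N x).

Definition simple_ring (A : nzRingType) : Prop :=
  forall I : A -> Prop, two_sided_ideal I ->
    (forall x, I x -> x = 0) \/ (forall x, I x).

(* A, viewed as a K-algebra through f, is central simple over K (in particular
   finite dimensional). *)
Definition central_simple (K : fieldType) (A : nzRingType)
    (f : {rmorphism K -> A}) : Prop :=
  [/\ simple_ring A,
      forall x : A, (forall y, x * y = y * x) <-> (exists c, x = f c)
    & exists n, has_dim (restrict_scalars f A^o) n].

Definition division_ring (D : nzRingType) : Prop :=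
  forall x : D, x != 0 -> exists y, x * y = 1 /\ y * x = 1.

Definition alg_iso (F : fieldType) (A B : algType F) : Prop :=
  exists f : {lrmorphism A -> B}, bijective f.

(* A is isomorphic to M_n(D) as an F-algebra; F acts on M_n(D) through the
   scalar matrices with entries in F 1_D. *)
Definition matrix_iso (F : fieldType) (A : algType F) (n : nat) (D : algType F)
    : Prop :=
  exists f : {rmorphism A -> 'M[D]_n},
    bijective f /\ forall c : F, f c%:A = (c%:A : D)%:M.

(* K = F(sqrt d). *)
Definition adjoins_sqrt (F : fieldType) (d : F) (K : fieldExtType F) : Prop :=
  exists s : K, s ^+ 2 = d%:A /\ <<1; s>>%VS = fullv.

(* Main.v *)
(** Diagonalize the bracket form on the quotient by its radical.  Conjugation by
    the elements e_i of an orthogonal basis multiplies each monomial e_S by a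
    sign, so averaging over these conjugations projects C_q onto the span of the
    central monomials, which are 1 and, for k(q) odd, the volume element z.
    Applied to x e_S this isolates the coefficient of e_S in x; as z^2 is not a
    square in F_q, this gives at once dim C_q = 2^k(q), simplicity and the
    center.  That z^2 is not a square comes from the grading: up to squares it is
    a principal k(q) x k(q) minor of the bracket matrix, the class of a
    homogeneous polynomial of odd degree.

    If C_q = M_N(D) and d = dim D, then 2^k(q) = N^2 d and dim L = N d.  Hence
    (dim L)^2 = 2^k(q) d, which turns both statements into d = 1 and d = 2. *)

Require Import Defs.
From HB Require Import structures.
From mathcomp Require Import all_boot all_order all_algebra.
From mathcomp Require Import fraction ring_quotient falgebra fieldext.
From mathcomp Require Import boolp reals complex.
From mathcomp.multinomials Require Import monalg mpoly.

Set Implicit Arguments.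
Unset Strict Implicit.
Unset Printing Implicit Defensive.

Import GRing.Theory.
Local Open Scope ring_scope.

(** * Dimension *)

(** No model of C_q is built to see that the monomials e_S are independent. A relation with a
    nonzero coefficient is an element of the zero ideal, and averaging produces from it an
    invertible element of that ideal, against 1 != 0. For odd rank that element is u + v z with u !=
    0, invertible because u^2 - v^2 z^2 does not vanish; so the nonsquare property is needed already
    for the dimension.

    F_q contains square roots of -1 and 2, because the complex numbers do. They absorb the sign of
    z^2 and the powers of 2 coming from 2 e_i^2 = B(e_i, e_i).

    A Gram matrix of the quotient space has arbitrary fractions as entries and carries no visible
    grading; this is why one passes to a minor of the bracket matrix, whose entries are classes of
    linear forms. Since q is homogeneous, sending a form p of degree d to p t^d embeds S(g_0)/q into
    polynomials in t over itself, and there p y^2 = x^2 with p of odd degree contradicts the parity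
    of degrees in t. *)

Section Dimension.
Variables (K : fieldType) (V : lmodType K).

Definition lin_indep (I : finType) (e : I -> V) :=
  forall x : I -> K, \sum_i x i *: e i = 0 -> forall i, x i = 0.

Definition spanning (I : finType) (e : I -> V) :=
  forall v, exists x : I -> K, v = \sum_i x i *: e i.

Lemma has_dim_basis (I : finType) (e : I -> V) :
  lin_indep e -> spanning e -> has_dim V #|I|.
Proof.
move=> ie se; exists (fun i => e (enum_val i)) => v.
have reidx (x : I -> K) :
    \sum_i x i *: e i = \sum_(j < #|I|) x (enum_val j) *: e (enum_val j).
  by rewrite big_enum_val.
have [x ->] := se v; exists (\row_j x (enum_val j)); split=> [|c].
  by rewrite reidx; apply: eq_bigr => j _; rewrite mxE.
move=> xc; apply/rowP=> j; rewrite mxE; apply/eqP.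
rewrite -subr_eq0; apply/eqP.
have := ie (fun i => x i - c 0 (enum_rank i)) _ (enum_val j).
rewrite enum_valK; apply.
rewrite (eq_bigr (fun i => x i *: e i - c 0 (enum_rank i) *: e i)) => [|i _];
  last by rewrite scalerBl.
rewrite sumrB xc (reidx (fun i => c 0 (enum_rank i))) -sumrB big1 // => i _.
by rewrite enum_valK subrr.
Qed.

Lemma has_dim_family n :
  has_dim V n -> exists e : 'I_n -> V, lin_indep e /\ spanning e.
Proof.
move=> [e he]; exists e; split=> [x x0 i|v]; last first.
  by have [x [-> _]] := he v; exists (x 0).
have [c [_ cu]] := he 0.
have /(congr1 (fun r : 'rV_n => r 0 i)) : \row_i x i = 0.
  transitivity c; first apply/esym/cu.
    by rewrite -[LHS]x0; apply: eq_bigr => j _; rewrite mxE.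
  by apply/cu; rewrite big1 // => j _; rewrite mxE scale0r.
by rewrite !mxE.
Qed.

(** The coordinates of the family in a spanning family of [n] vectors form a matrix with free
    rows. *)
Lemma lin_indep_leq (I : finType) (e : I -> V) n :
  has_dim V n -> lin_indep e -> (#|I| <= n)%N.
Proof.
move=> /has_dim_family[b [_ sb]] ie.
have [M eM] : exists M : I -> 'I_n -> K, forall i, e i = \sum_j M i j *: b j.
  by have [M eM] := choice (fun i => sb (e i)); exists M.
pose A := \matrix_(i < #|I|, j < n) M (enum_val i) j.
suff fA : row_free A by rewrite -(eqP fA) rank_leq_col.
apply: inj_row_free => v vA; apply/rowP=> j; rewrite mxE.
have := ie (fun i => v 0 (enum_rank i)) _ (enum_val j); rewrite enum_valK; apply.
rewrite (eq_bigr (fun i => \sum_l (v 0 (enum_rank i) * M i l) *: b l)) => [|i _].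
  rewrite exchange_big big1 //= => l _; rewrite -scaler_suml.
  have /(congr1 (fun r : 'rV_n => r 0 l)) := vA; rewrite !mxE => vAl.
  rewrite big_enum_val (eq_bigr (fun i => v 0 i * A i l)) ?vAl ?scale0r //.
  by move=> i _; rewrite enum_valK mxE.
by rewrite eM scaler_sumr; apply: eq_bigr => l _; rewrite scalerA.
Qed.

Lemma has_dim_unique n m : has_dim V n -> has_dim V m -> n = m.
Proof.
move=> dn dm; have [e [ie _]] := has_dim_family dn.
have [f [jf _]] := has_dim_family dm.
apply/eqP; rewrite eqn_leq -[leqLHS]card_ord (lin_indep_leq dm ie) /=.
by rewrite -[leqLHS]card_ord (lin_indep_leq dn jf).
Qed.

Lemma lin_indep_extend (I : finType) (e : I -> V) v :
    lin_indep e -> (forall x : I -> K, v <> \sum_i x i *: e i) ->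
  lin_indep (oapp e v).
Proof.
move=> ie nv x.
have -> : \sum_o x o *: oapp e v o = x None *: v + \sum_i x (Some i) *: e i.
  rewrite (bigD1 None) //=; congr (_ + _).
  rewrite (reindex_omap Some id) /=; last by case.
  by apply: eq_bigl => i; rewrite eqxx.
move=> x0; have xz : x None = 0.
  apply/eqP/negP=> /negP xn0; apply: (nv (fun i => - (x None)^-1 * x (Some i))).
  rewrite (eq_bigr (fun i => - (x None)^-1 *: (x (Some i) *: e i))) => [|i _];
    last by rewrite scalerA.
  have E : \sum_i x (Some i) *: e i = - (x None *: v).
    by apply/eqP; rewrite -addr_eq0 addrC x0.
  by rewrite -scaler_sumr E scalerN scaleNr opprK scalerA mulVf // scale1r.
move: x0; rewrite xz scale0r add0r => /ie xS [i|] //; exact: xS.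
Qed.

(** An independent family of maximal size spans. This gives finite dimension where no basis is at
    hand, as for the division algebra [D]. *)
Lemma bounded_has_dim m :
    (forall (I : finType) (e : I -> V), lin_indep e -> (#|I| <= m)%N) ->
  exists n, has_dim V n.
Proof.
move=> bnd; pose P n :=
  `[< exists (I : finType) (e : I -> V), #|I| = n /\ lin_indep e >].
have exP : exists n, P n.
  by exists #|{: void}|; apply/asboolP; exists void, (fun=> 0); split=> // x _ [].
have Pm n : P n -> (n <= m)%N by move=> /asboolP[I [e [<-]]]; apply: bnd.
case: (ex_maxnP exP Pm) => n /asboolP[I [e [<- ie]]] maxn; exists #|I|.
apply: (has_dim_basis ie) => v; apply: contrapT => nv.
suff /maxn : P #|I|.+1 by rewrite ltnn.
apply/asboolP; exists (option I), (oapp e v); rewrite card_option; split=> //.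
by apply: lin_indep_extend => // x vx; apply: nv; exists x.
Qed.

Lemma lin_indep_spanning (I : finType) (e : I -> V) :
  has_dim V #|I| -> lin_indep e -> spanning e.
Proof.
move=> dV ie v; apply: contrapT => nv.
suff ie' : lin_indep (oapp e v).
  by have := lin_indep_leq dV ie'; rewrite card_option ltnn.
by apply: lin_indep_extend => // x vx; apply: nv; exists x.
Qed.

Lemma has_dim_gt0 n (v : V) : v != 0 -> has_dim V n -> (0 < n)%N.
Proof.
move=> vn0 [e he]; case: n e he => // e /(_ v)[c [/eqP]].
by rewrite big_ord0 (negPf vn0).
Qed.

End Dimension.
Arguments lin_indep {K V I} e.
Arguments spanning {K V I} e.

Section DimensionMaps.
Variables (K : fieldType) (V W : lmodType K) (h : {linear V -> W}).

Lemma lin_indep_map (I : finType) (e : I -> V) :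
  injective h -> lin_indep e -> lin_indep (h \o e).
Proof.
move=> hI ie x x0; apply: ie; apply: hI; rewrite linear0 -{}x0 linear_sum.
by apply: eq_bigr => i _; rewrite linearZ_LR.
Qed.

Lemma has_dim_inj m : injective h -> has_dim W m -> exists n, has_dim V n.
Proof.
move=> hI dW; apply: (bounded_has_dim (m := m)) => I e ie.
exact: lin_indep_leq dW (lin_indep_map hI ie).
Qed.

Lemma has_dim_iso n :
  injective h -> (forall w, exists v, h v = w) -> has_dim V n -> has_dim W n.
Proof.
move=> hI hS /has_dim_family[e [ie se]]; rewrite -(card_ord n).
apply: (has_dim_basis (lin_indep_map hI ie)) => w.
have [v <-] := hS w; have [x ->] := se v; exists x.
by rewrite linear_sum; apply: eq_bigr => i _; rewrite linearZ_LR.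
Qed.

Lemma linear_inj_surj n :
  injective h -> has_dim V n -> has_dim W n -> forall w, exists v, h v = w.
Proof.
move=> hI /has_dim_family[e [ie se]] dW w.
rewrite -(card_ord n) in dW.
have [x ->] := lin_indep_spanning dW (lin_indep_map hI ie) w.
exists (\sum_i x i *: e i); rewrite linear_sum.
by apply: eq_bigr => i _; rewrite linearZ_LR.
Qed.

End DimensionMaps.

(** The hypotheses say that [W] is the direct sum of copies of [V] embedded by the [h i]. It serves
    for the N * N entries of a matrix algebra over [D] and for the N entries of a column. *)
Lemma has_dim_sum (K : fieldType) (I : finType) (V W : lmodType K)
    (h : I -> {linear V -> W}) n :
    (forall x : I -> V, \sum_i h i (x i) = 0 -> forall i, x i = 0) ->
    (forall w, exists x : I -> V, w = \sum_i h i (x i)) ->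
  has_dim V n -> has_dim W (#|I| * n).
Proof.
move=> hI hS /has_dim_family[e [ie se]]; rewrite -[n in X in has_dim _ X]card_ord -card_prod.
have E (x : I * 'I_n -> K) : \sum_p x p *: h p.1 (e p.2) =
    \sum_i h i (\sum_j x (i, j) *: e j).
  rewrite (eq_bigr (fun p => x (p.1, p.2) *: h p.1 (e p.2))) => [|[] //].
  rewrite -(pair_bigA _ (fun i j => x (i, j) *: h i (e j))) /=; apply: eq_bigr => i _.
  by rewrite linear_sum; apply: eq_bigr => j _; rewrite linearZ_LR.
apply: (@has_dim_basis _ _ _ (fun p => h p.1 (e p.2))) => [x|w].
  by rewrite E => /hI x0 [i j]; apply: (ie (fun j => x (i, j)) (x0 i)).
have [x ->] := hS w; have [c xc] := choice (fun i => se (x i)).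
exists (fun p => c p.1 p.2); rewrite E; apply: eq_bigr => i _.
by rewrite xc.
Qed.

(** * Simple algebras are matrix algebras *)

Section Corner.
Variables (F : fieldType) (A : algType F) (e : A).

Definition corner_pred : {pred A} := [pred x | e * x * e == x].

Fact corner_submod_closed : submod_closed corner_pred.
Proof.
split=> [|a x y]; rewrite !inE ?mulr0 ?mul0r // => /eqP xE /eqP yE.
by rewrite mulrDr mulrDl yE -scalerAr -scalerAl xE.
Qed.
HB.instance Definition _ := GRing.isSubmodClosed.Build F A corner_pred
  corner_submod_closed.

(** The ring e A e, with unit [e]. The two proofs are parameters of the type so that the ring
    instances can use that [e] is a unit and is nonzero. *)
Record corner (ee : e * e = e) (e_neq0 : e != 0) :=
  Corner { corner_val : A; _ : corner_val \in corner_pred }.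

Variables (ee : e * e = e) (e_neq0 : e != 0).
Notation D := (corner ee e_neq0).

HB.instance Definition _ := [isSub of D for @corner_val ee e_neq0].
HB.instance Definition _ := [Choice of D by <:].
HB.instance Definition _ := [SubChoice_isSubLmodule of D by <:].

Lemma corner_valE (x : D) : e * val x * e = val x.
Proof. exact/eqP/(valP x). Qed.

Lemma corner_mulel (x : D) : e * val x = val x.
Proof. by rewrite -corner_valE !mulrA ee. Qed.

Lemma corner_muler (x : D) : val x * e = val x.
Proof. by rewrite -corner_valE -!mulrA ee. Qed.

Fact corner_one_subproof : e \in corner_pred.
Proof. by rewrite inE !ee. Qed.
Fact corner_mul_subproof (x y : D) : val x * val y \in corner_pred.
Proof. by rewrite inE mulrA corner_mulel -mulrA corner_muler. Qed.

Definition corner_one : D := Corner ee e_neq0 corner_one_subproof.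
Definition corner_mul (x y : D) : D :=
  Corner ee e_neq0 (corner_mul_subproof x y).

Fact corner_mulA : associative corner_mul.
Proof. by move=> x y z; apply: val_inj; rewrite /= mulrA. Qed.
Fact corner_mul1x : left_id corner_one corner_mul.
Proof. by move=> x; apply: val_inj; rewrite /= corner_mulel. Qed.
Fact corner_mulx1 : right_id corner_one corner_mul.
Proof. by move=> x; apply: val_inj; rewrite /= corner_muler. Qed.
Fact corner_mulDl : left_distributive corner_mul +%R.
Proof. by move=> x y z; apply: val_inj; rewrite /= mulrDl. Qed.
Fact corner_mulDr : right_distributive corner_mul +%R.
Proof. by move=> x y z; apply: val_inj; rewrite /= mulrDr. Qed.
Fact corner_one_neq0 : corner_one != 0.
Proof. by rewrite -val_eqE. Qed.

HB.instance Definition _ := GRing.Zmodule_isNzRing.Build D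
  corner_mulA corner_mul1x corner_mulx1 corner_mulDl corner_mulDr
  corner_one_neq0.

Fact corner_scalerAl (a : F) (x y : D) : a *: (x * y) = (a *: x) * y.
Proof. by apply: val_inj; rewrite /= scalerAl. Qed.
HB.instance Definition _ := GRing.Lmodule_isLalgebra.Build F D corner_scalerAl.

Fact corner_scalerAr (a : F) (x y : D) : a *: (x * y) = x * (a *: y).
Proof. by apply: val_inj; rewrite /= scalerAr. Qed.
HB.instance Definition _ := GRing.Lalgebra_isAlgebra.Build F D corner_scalerAr.

Lemma corner_valM (x y : D) : val (x * y) = val x * val y. Proof. by []. Qed.
Lemma corner_valB (x y : D) : val (x - y) = val x - val y. Proof. by []. Qed.
Lemma corner_val_sum (I : finType) (f : I -> D) :
  val (\sum_i f i) = \sum_i val (f i).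
Proof. exact: (raddf_sum (val : D -> A)). Qed.

End Corner.

(** * Minimal idempotents and the theorem of Wedderburn *)

Section MinimalLeftIdeal.
Variables (F : fieldType) (A : algType F) (n : nat).
Hypothesis dimA : has_dim A n.

(* The left ideal A x of minimal positive dimension: that dimension is the rank
   of the matrix of right multiplication by x. *)
Lemma exists_minimal_left_ideal : exists2 x : A, x != 0 &
  forall a, a * x != 0 -> exists b, x = b * (a * x).
Proof.
have [b [ib sb]] := has_dim_family dimA; have [r rE] := choice sb.
have lrE v : v = \sum_j (\row_j r v j) 0 j *: b j.
  by rewrite [LHS]rE; apply: eq_bigr => j _; rewrite mxE.
pose comb (v : 'rV[F]_n) := \sum_j v 0 j *: b j.
have combK v : \row_j r (comb v) j = v.
  apply/rowP=> j; rewrite mxE; apply/eqP; rewrite -subr_eq0; apply/eqP.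
  apply: (ib (fun j => r (comb v) j - v 0 j)).
  under eq_bigr do rewrite scalerBl.
  by rewrite sumrB -rE subrr.
pose M x := \matrix_(i, j) r (b i * x) j.
have combM v x : comb (v *m M x) = comb v * x.
  rewrite mulr_suml /comb.
  under eq_bigr do rewrite mxE scaler_suml.
  rewrite exchange_big; apply: eq_bigr => i _.
  rewrite -scalerAl [b i * x]rE scaler_sumr; apply: eq_bigr => j _.
  by rewrite mxE scalerA.
pose P d := `[< exists2 x : A, x != 0 & \rank (M x) = d >].
have exP : exists d, P d.
  by exists (\rank (M 1)); apply/asboolP; exists 1; rewrite ?oner_neq0.
case: (ex_minnP exP) => d /asboolP[x xn0 <-] minx; exists x => // a axn0.
(* A (a x) lies in A x, and minimality of the rank turns the inclusion into an equality; x, being 1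
   x, is then a left multiple of a x. *)
have le_ax : (M (a * x)%R <= M x)%MS.
  apply/row_subP=> i; apply/submxP; exists (\row_j r (b i * a) j).
  rewrite -[RHS]combK combM /comb -lrE -mulrA.
  by apply/rowP=> j; rewrite !mxE.
have le_xa : (M x <= M (a * x)%R)%MS.
  rewrite -(geq_leqif (mxrank_leqif_sup le_ax)); apply: minx; apply/asboolP.
  by exists (a * x).
have /submxP[T MT] := le_xa.
exists (comb ((\row_j r 1 j) *m T)).
by rewrite -combM -mulmxA -MT combM /comb -lrE mul1r.
Qed.

Hypothesis simpleA : simple_ring A.

(** Membership in the ideal generated by [y]. The number of terms is recorded because [wedderburn]
    takes a shortest such expression of 1. *)
Definition gen_sum (y : A) (m : nat) (x : A) := exists u v : 'I_m -> A,
  x = \sum_i u i * y * v i.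

Lemma gen_sum_all y x : y != 0 -> exists m, gen_sum y m x.
Proof.
move=> yn0; case: (simpleA (I := fun x => exists m, gen_sum y m x)) => //.
  split=> [|x1 x2 [m1 [u1 [v1 ->]]] [m2 [u2 [v2 ->]]]|a z [m [u [v ->]]]].
  - by exists 0%N, (fun=> 0), (fun=> 0); rewrite big_ord0.
  - exists (m1 + m2)%N.
    exists (fun i => match split i with inl j => u1 j | inr j => - u2 j end).
    exists (fun i => match split i with inl j => v1 j | inr j => v2 j end).
    rewrite big_split_ord /= -sumrN; congr (_ + _); apply: eq_bigr => i _.
      by rewrite (unsplitK (inl i)).
    by rewrite (unsplitK (inr i)) !mulNr.
  - split; exists m.
      exists (fun i => a * u i), v; rewrite mulr_sumr.
      by apply: eq_bigr => i _; rewrite !mulrA.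
    exists u, (fun i => v i * a); rewrite mulr_suml.
    by apply: eq_bigr => i _; rewrite !mulrA.
move=> /(_ y) H; case/negP: yn0; apply/eqP/H.
by exists 1%N, (fun=> 1), (fun=> 1); rewrite big_ord1 mul1r mulr1.
Qed.

(** Brauer's lemma: a minimal left ideal that does not square to zero contains a nonzero idempotent.
    The last clause expresses the minimality of A e. *)
Lemma exists_minimal_idempotent : exists e : A, [/\ e * e = e, e != 0 &
  forall y, y != 0 -> y * e = y -> exists b, b * y = e].
Proof.
have [x xn0 minx] := exists_minimal_left_ideal.
(* If x A x were zero, the two-sided ideal generated by x would have square zero, although it
   contains 1. *)
have [a xax] : exists a, x * (a * x) != 0.
  apply: contrapT => nx; have [m [u [v one]]] := gen_sum_all 1 xn0.
  have /eqP[] := oner_neq0 A.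
  rewrite -[1](mulr1 1) {1}one mulr_suml big1 // => i _.
  rewrite one mulr_sumr big1 // => j _.
  have -> : u i * x * v i * (u j * x * v j) =
    u i * (x * (v i * u j * x)) * v j by rewrite !mulrA.
  case: (eqVneq (x * (v i * u j * x)) 0) => [->|/negP/negP]; first by rewrite mulr0 mul0r.
  by move=> nz; case: nx; exists (v i * u j).
have [b xE] : exists b, x = b * (x * (a * x)).
  by move: xax; rewrite mulrA => /minx.
set z := a * x in xax xE; pose e := a * b * x.
have ez : e * z = z by rewrite /e -!mulrA -xE.
have en0 : e != 0.
  by apply: contraNneq xax => e0; rewrite -ez e0 mul0r mulr0.
(* [e * e - e] lies in A x and kills [z]. Were it nonzero, x would be a left multiple of it and x z
   would vanish. *)
have ee : e * e = e.
  apply/eqP; rewrite -subr_eq0; apply/negP=> /negP wn0.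
  have wE : e * e - e = (e * a * b - a * b) * x by rewrite mulrBl /e !mulrA.
  have [|c xc] := minx (e * a * b - a * b); first by rewrite -wE.
  case/negP: xax; rewrite -/z xc -?wE // -mulrA mulrBl -mulrA !ez subrr mulr0.
  by rewrite eqxx.
exists e; split=> // y yn0 ye.
(* As y = y e lies in A x, minimality makes x a left multiple of y, and hence e as well. *)
have yE : y = y * a * b * x by rewrite -{1}ye /e !mulrA.
have [|c xc] := minx (y * a * b); first by rewrite -yE.
by exists (a * b * c); rewrite /e [in RHS]xc -yE !mulrA.
Qed.

Lemma corner_division (e : A) (ee : e * e = e) (en0 : e != 0) :
    (forall y, y != 0 -> y * e = y -> exists b, b * y = e) ->
  division_ring (corner ee en0).
Proof.
move=> mine.
have linv (d : corner ee en0) : d != 0 -> exists b : corner ee en0, b * d = 1.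
  move=> dn0; have [b bd] := mine (val d) dn0 (corner_muler d).
  have be : e * b * e \in corner_pred e by rewrite inE !mulrA ee -!mulrA ee.
  exists (Corner ee en0 be); apply: val_inj => /=.
  by rewrite -!mulrA corner_mulel bd ee.
move=> d dn0; have [b bd] := linv d dn0.
have [|c cb] := linv b; first by apply: contraTneq isT => b0; move: bd;
  rewrite b0 mul0r => /esym/eqP; rewrite oner_eq0.
exists b; split=> //.
by have -> : d = c by rewrite -[d]mul1r -cb -mulrA bd mulr1.
Qed.

(** Let D = e A e. In a shortest expression 1 = sum_i u_i v_i with u_i in A e and v_i in e A, the
    u_i form a basis of the right D-module A e, with dual basis v_i. The isomorphism sends x to the
    matrix (v_i x u_j) of left multiplication by x on A e. *)
Theorem wedderburn : exists (m : nat) (D : algType F),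
  division_ring D /\ matrix_iso A m D.
Proof.
have [e [ee en0 mine]] := exists_minimal_idempotent.
have divD := corner_division (ee := ee) (en0 := en0) mine.
have exm : exists m, `[< gen_sum e m 1 >].
  by have [m ?] := gen_sum_all 1 en0; exists m; apply/asboolP.
case: (ex_minnP exm) => m /asboolP[u' [v' one']] minm.
exists m, (corner ee en0); split=> //.
have [u [v [ue ev one]]] : exists u v : 'I_m -> A,
    [/\ forall i, u i * e = u i, forall i, e * v i = v i &
      1 = \sum_i u i * v i].
  exists (fun i => u' i * e), (fun i => e * v' i).
  split=> [i|i|]; [by rewrite -mulrA ee | by rewrite mulrA ee |].
  by rewrite one'; apply: eq_bigr => i _; rewrite !mulrA -(mulrA _ e e) ee.
clear u' v' one'.
(* A nontrivial relation between the [u i] would shorten the sum. *)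
have indu (d : 'I_m -> corner ee en0) :
    \sum_i u i * val (d i) = 0 -> forall i, d i = 0.
  move=> d0 k; apply/eqP/negP=> /negP dkn0; have [d' [dd' _]] := divD _ dkn0.
  have [m' mE] : exists m', m = m'.+1.
    by exists m.-1; rewrite prednK // (leq_ltn_trans _ (ltn_ord k)).
  subst m.
  have /minm : `[< gen_sum e m' 1 >]; last by rewrite ltnn.
  apply/asboolP; exists (fun j => u (lift k j)).
  exists (fun j => v (lift k j) - val (d (lift k j)) * val d' * v k).
  rewrite {1}one (bigD1_ord k) //=.
  have -> : u k = - \sum_j u (lift k j) * val (d (lift k j)) * val d'.
    have dd'E : val (d k) * val d' = e by rewrite -corner_valM dd'.
    rewrite -{1}(ue k) -[in LHS]dd'E mulrA.
    move/eqP: d0; rewrite (bigD1_ord k) //= addr_eq0 => /eqP ->.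
    by rewrite mulNr mulr_suml.
  rewrite mulNr mulr_suml addrC -sumrB; apply: eq_bigr => j _.
  by rewrite ue mulrBr !mulrA.
have cP i x j : v i * x * u j \in corner_pred e.
  by rewrite inE !mulrA ev -!mulrA ue.
pose c i x j := Corner ee en0 (cP i x j).
(* From 1 = sum_i u_i v_i one gets sum_i u_i (v_i u_j) = u_j = u_j e, and independence of the u_i
   compares coefficients. *)
have uv i j : v i * u j = if i == j then e else 0.
  pose d i := c i 1 j - (if i == j then 1 else 0).
  have /indu/(_ i) : \sum_i u i * val (d i) = 0.
    rewrite (eq_bigr (fun i => u i * v i * u j - (if i == j then u i else 0))).
      by rewrite sumrB -mulr_suml -one mul1r -big_mkcond big_pred1_eq subrr.
    move=> l _; rewrite corner_valB mulrBr /= mulr1 mulrA; congr (_ - _).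
    by case: eqP; rewrite /= ?ue ?mulr0.
  move/eqP; rewrite subr_eq0 => /eqP/(congr1 val); rewrite /= mulr1 => ->.
  by case: eqP.
pose f x : 'M[corner ee en0]_m := \matrix_(i, j) c i x j.
have fz : zmod_morphism f.
  move=> x y; apply/matrixP=> i j; rewrite !mxE; apply: val_inj.
  by rewrite /= mulrBr mulrBl.
have fm : monoid_morphism f.
  split=> [|x y]; apply/matrixP=> i j; rewrite !mxE; apply: val_inj.
    by rewrite /= mulr1 uv; case: eqP.
  rewrite corner_val_sum /=.
  rewrite (eq_bigr (fun l => v i * x * (u l * v l) * (y * u j))) => [|l _].
    by rewrite -mulr_suml -mulr_sumr -one mulr1 !mulrA.
  by rewrite !mxE /= !mulrA.
pose F1 := GRing.isZmodMorphism.Build _ _ f fz.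
pose F2 := GRing.isMonoidMorphism.Build _ _ f fm.
pose f' : {rmorphism A -> 'M[corner ee en0]_m} := HB.pack f F1 F2.
exists f'; split=> /=; last first.
  move=> a; apply/matrixP=> i j; rewrite !mxE; apply: val_inj => /=.
  rewrite -scalerAr -scalerAl mulr1 uv.
  by case: eqP; rewrite ?mulr1n ?mulr0n /= ?scaler0.
exists (fun M : 'M[corner ee en0]_m => \sum_i \sum_j u i * val (M i j) * v j) => [x|M].
  rewrite -[RHS]mul1r [in RHS]one mulr_suml; apply: eq_bigr => i _.
  rewrite -[in RHS](mulr1 x) [in RHS]one !mulr_sumr; apply: eq_bigr => j _.
  by rewrite mxE /= !mulrA.
apply/matrixP=> i j; rewrite mxE; apply: val_inj.
rewrite -[LHS]/(v i * (\sum_l \sum_p u l * val (M l p) * v p) * u j).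
rewrite mulr_sumr mulr_suml (bigD1 i) //= [X in _ + X]big1 => [|l li].
  rewrite mulr_sumr mulr_suml (bigD1 j) //= [X in _ + X + _]big1 => [|l lj].
    by rewrite !addr0 !mulrA uv eqxx -!mulrA uv eqxx corner_muler corner_mulel.
  by rewrite -!mulrA uv (negPf lj) !mulr0.
rewrite mulr_sumr mulr_suml big1 // => p _.
by rewrite !mulrA uv eq_sym (negPf li) !mul0r.
Qed.

End MinimalLeftIdeal.

(** * Dimensions of a matrix algebra and of its simple modules *)

Section MatrixAlgebra.
Variables (F : fieldType) (A D : algType F) (N : nat).
Variables (f : {rmorphism A -> 'M[D]_N}) (g : 'M[D]_N -> A).
Hypotheses (fK : cancel f g) (gK : cancel g f).
Hypothesis fF : forall c : F, f c%:A = (c%:A : D)%:M.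

Let fM x y : f (x * y) = f x *m f y := rmorphM f x y.
Let f1 : f 1 = 1%:M := rmorph1 f.
Let f0 : f 0 = 0 := rmorph0 f.
Let fD x y : f (x + y) = f x + f y := rmorphD f x y.
Let f_sum (I : finType) (h : I -> A) : f (\sum_i h i) = \sum_i f (h i) :=
  rmorph_sum f _ _ h.

Lemma matrix_isoZ c a : f (c *: a) = (c%:A : D) *: f a.
Proof. by rewrite -[c *: a]mulr_algl fM fF -mul_scalar_mx. Qed.

Definition mxunit (i j : 'I_N) (x : D) : A := g (x *: delta_mx i j).

Lemma mxunitK i j x : f (mxunit i j x) = x *: delta_mx i j.
Proof. exact: gK. Qed.

Fact mxunit_linear i j : linear (mxunit i j).
Proof.
move=> c x y; apply: (can_inj fK); rewrite fD matrix_isoZ !mxunitK.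
by rewrite scalerDl -[in LHS]mulr_algl scalerA.
Qed.
HB.instance Definition _ i j := GRing.isLinear.Build F D A _ (mxunit i j)
  (mxunit_linear i j).

Lemma mxunitM i j k l x y :
  mxunit i j x * mxunit k l y = if j == k then mxunit i l (x * y) else 0.
Proof.
apply: (can_inj fK); rewrite fM !mxunitK.
apply/matrixP=> s t; rewrite mxE (bigD1 j) //= big1 => [|r rj].
  rewrite addr0 !mxE eqxx andbT; case: (eqVneq j k) => [_|jk] /=.
    rewrite mxunitK !mxE; case: (s == i); case: (t == l);
    by rewrite /= ?mulr1 ?mulr0 ?mul0r.
  by rewrite f0 mxE !mulr0.
by rewrite !mxE (negPf rj) andbF mulr0 mul0r.
Qed.

Lemma mxunit_sum a : a = \sum_i \sum_j mxunit i j (f a i j).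
Proof.
apply: (can_inj fK); rewrite f_sum [LHS]matrix_sum_delta.
apply: eq_bigr => i _; rewrite f_sum; apply: eq_bigr => j _.
by rewrite mxunitK.
Qed.

Lemma mxunit1 : 1 = \sum_i mxunit i i 1.
Proof.
rewrite [LHS]mxunit_sum; apply: eq_bigr => i _; rewrite (bigD1 i) //= big1 => [|j ji].
  by rewrite addr0 f1 mxE eqxx.
by rewrite f1 mxE eq_sym (negPf ji) linear0.
Qed.

Lemma mul_mxunit a j l x :
  a * mxunit j l x = \sum_i mxunit i l (f a i j * x).
Proof.
rewrite {1}(mxunit_sum a) mulr_suml; apply: eq_bigr => i _.
rewrite mulr_suml (bigD1 j) //= big1 => [|k kj]; rewrite mxunitM ?eqxx ?addr0 //.
by rewrite (negPf kj).
Qed.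

Lemma mxunit_inj i j : injective (mxunit i j).
Proof.
move=> x y /(congr1 f)/matrixP/(_ i j); rewrite !mxunitK !mxE !eqxx.
by rewrite !mulr1.
Qed.

Lemma has_dim_entries m (i : 'I_N) : has_dim A m -> exists d, has_dim D d.
Proof. exact: has_dim_inj (@mxunit_inj i i). Qed.

Lemma has_dim_matrix_iso d : has_dim D d -> has_dim A (N * N * d).
Proof.
rewrite -[N in (N * N)%N]card_ord -card_prod => dD.
have E (x : 'I_N * 'I_N -> D) : \sum_p mxunit p.1 p.2 (x p) =
    \sum_i \sum_j mxunit i j (x (i, j)).
  rewrite (eq_bigr (fun p => mxunit p.1 p.2 (x (p.1, p.2)))) => [|[] //].
  by rewrite -(pair_bigA _ (fun i j => mxunit i j (x (i, j)))).
apply: (has_dim_sum (h := fun p => mxunit p.1 p.2)) dD => [x|a]; last first.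
  by exists (fun p => f a p.1 p.2); rewrite E [LHS]mxunit_sum.
rewrite E => x0 [i j].
have /(congr1 f)/matrixP/(_ i j) := x0.
rewrite f0 mxE => <-; rewrite f_sum summxE (bigD1 i) //= [X in _ + X]big1 => [|k ki].
  rewrite f_sum summxE (bigD1 j) //= [X in _ + X + _]big1 => [|l lj].
    by rewrite mxunitK !mxE !eqxx mulr1 !addr0.
  by rewrite mxunitK !mxE eq_sym (negPf lj) andbF mulr0.
rewrite f_sum summxE big1 // => l _.
by rewrite mxunitK !mxE eq_sym (negPf ki) mulr0.
Qed.

Variable L : lmodType A.
Hypotheses (divD : division_ring D) (simpleL : simple_module L).

(** L is a column space D^N. As 1 is the sum of the diagonal units, one of them does not kill a
    given nonzero vector; call the image v. Columns map to L by applying the units in column [i0] to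
    v: the map is injective since nonzero entries are invertible, and its image is a nonzero
    submodule. *)
Lemma has_dim_simple_module d :
  has_dim D d -> has_dim (restrict_scalars (in_alg A) L) (N * d).
Proof.
rewrite -[X in (X * d)%N]card_ord => dD.
have [[v0 /eqP v0n0] minL] := simpleL.
have [i0 vn0] : exists i, mxunit i i 1 *: v0 != 0.
  apply: contrapT => nv; case/negP: v0n0; rewrite -[v0]scale1r mxunit1.
  rewrite scaler_suml big1 // => i _; apply/eqP/negP=> /negP vi; case: nv.
  by exists i.
set v := _ *: v0 in vn0.
have vE : mxunit i0 i0 1 *: v = v by rewrite scalerA mxunitM eqxx mulr1.
pose h j (x : D) : restrict_scalars (in_alg A) L := mxunit j i0 x *: v.
have hlin j : linear (h j).
  move=> c x y; rewrite /h linearP scalerDl; congr (_ + _).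
  by rewrite -[X in X *: v]mulr_algl -scalerA.
pose h' j : {linear D -> restrict_scalars (in_alg A) L} :=
  HB.pack (h j) (GRing.isLinear.Build _ _ _ _ (h j) (hlin j)).
apply: (has_dim_sum (h := h')) dD => [x x0 k|w].
  apply/eqP/negP=> /negP xkn0; have [y [_ yx]] := divD xkn0.
  case/negP: vn0; rewrite -vE; have := congr1 (fun w : L => mxunit i0 k y *: w) x0.
  rewrite scaler0 scaler_sumr (bigD1 k) //= big1 => [|j jk].
    by rewrite addr0 scalerA mxunitM eqxx yx => ->.
  by rewrite scalerA mxunitM eq_sym (negPf jk) scale0r.
pose S (w : L) := exists x : 'I_N -> D, w = \sum_j mxunit j i0 (x j) *: v.
have [] := minL S.
- by exists (fun=> 0); rewrite big1 // => j _; rewrite linear0 scale0r.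
- move=> _ _ [x ->] [y ->]; exists (fun j => x j + y j); rewrite -big_split.
  by apply: eq_bigr => j _; rewrite linearD scalerDl.
- move=> a _ [x ->]; exists (fun j => \sum_k f a j k * x k).
  rewrite scaler_sumr (eq_bigr (fun j =>
    \sum_i mxunit i i0 (f a i j * x j) *: v)) => [|j _].
    rewrite exchange_big; apply: eq_bigr => i _.
    by rewrite linear_sum scaler_suml.
  by rewrite scalerA mul_mxunit scaler_suml.
- move=> S0; case/eqP: vn0; apply: S0.
  exists (fun j => if j == i0 then 1 else 0); rewrite (bigD1 i0) //= big1 => [|j ji].
    by rewrite addr0 eqxx vE.
  by rewrite (negPf ji) linear0 scale0r.
- by apply.
Qed.

End MatrixAlgebra.

Lemma matrix_iso_gt0 (F : fieldType) (A D : algType F) (N : nat) :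
  matrix_iso A N D -> (0 < N)%N.
Proof.
move=> [f [[g fK _] _]]; case: N f g fK => // f g fK.
by have /eqP[] := oner_neq0 A; apply: (can_inj fK); apply/matrixP=> -[].
Qed.

Lemma matrix_iso_dim (F : fieldType) (A D : algType F) (N m : nat)
    (L : lmodType A) :
    has_dim A m -> division_ring D -> matrix_iso A N D -> simple_module L ->
  exists d, [/\ (0 < d)%N, has_dim D d, m = (N * N * d)%N &
    has_dim (restrict_scalars (in_alg A) L) (N * d)].
Proof.
move=> dA divD isoD simpleL; have N0 := matrix_iso_gt0 isoD.
have [f [[g fK gK] fF]] := isoD.
have [d dD] := has_dim_entries fK gK fF (Ordinal N0) dA.
exists d; split=> //.
- exact: has_dim_gt0 (oner_neq0 D) dD.
- exact: has_dim_unique dA (has_dim_matrix_iso fK gK fF dD).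
- exact: (has_dim_simple_module fK gK).
Qed.

(** * Algebras with anticommuting generators *)

Section AnticommutingGenerators.
Variables (F : fieldType) (A : algType F) (k : nat).
Variables (e : 'I_k -> A) (c : 'I_k -> F).
Hypotheses (two_neq0 : (2%:R : F) != 0) (c_neq0 : forall i, c i != 0).
Hypothesis sqr_e : forall i, e i * e i = (c i)%:A.
Hypothesis anticomm_e : forall i j, i != j -> e i * e j = - (e j * e i).
Hypothesis gen_e : forall P : A -> Prop, P 1 ->
  (forall a x y, P x -> P y -> P (a *: x + y)) ->
  (forall i x, P x -> P (e i * x)) -> forall x, P x.

Definition monom (S : {set 'I_k}) : A := \prod_(j <- enum S) e j.
Definition symdiff (S T : {set 'I_k}) := [set j | (j \in S) (+) (j \in T)].

Lemma monom0 : monom set0 = 1.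
Proof. by rewrite /monom enum_set0 big_nil. Qed.

Lemma e_prod i (l : seq 'I_k) :
  e i * \prod_(j <- l) e j =
  (-1) ^+ count (predC1 i) l *: (\prod_(j <- l) e j * e i).
Proof.
elim: l => [|j l IH]; first by rewrite !big_nil mulr1 mul1r scale1r.
rewrite !big_cons /= -(mulrA (e j)); case: (eqVneq j i) => [->|ji] /=.
  by rewrite add0n IH -scalerAr.
by rewrite add1n exprS -scalerA scalerAr -IH scaleN1r !mulrA anticomm_e 1?eq_sym // mulNr.
Qed.

Lemma e_monom_comm i S :
  e i * monom S = (-1) ^+ #|S :\ i| *: (monom S * e i).
Proof.
rewrite e_prod; congr ((-1) ^+ _ *: _); rewrite -size_filter cardE.
apply/perm_size/uniq_perm => [||j]; rewrite ?enum_uniq //.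
  by rewrite filter_uniq ?enum_uniq.
by rewrite mem_filter !mem_enum !inE.
Qed.

(** [e i] moves to its place in the ordered product at the cost of signs, and of the factor [c i] if
    it meets a copy of itself. Later arguments use only that the total factor is nonzero. *)
Lemma e_prod_insert i (S : {set 'I_k}) (l : seq 'I_k) : uniq l -> i \in l ->
  exists2 a : F, a != 0 & e i * \prod_(j <- l | j \in S) e j =
    a *: \prod_(j <- l | j \in symdiff [set i] S) e j.
Proof.
elim: l => // j l IH /andP[jl ul]; rewrite in_cons !big_cons !inE.
have same : i \notin l -> \prod_(j <- l | j \in symdiff [set i] S) e j =
    \prod_(j <- l | j \in S) e j.
  move=> il; rewrite big_seq_cond [RHS]big_seq_cond; apply: eq_bigl => t.
  rewrite !inE; case: (boolP (t \in l)) => //= tl.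
  by case: eqVneq tl il => // -> ->.
case: (eqVneq i j) => [ij _|ij /= il].
  rewrite -ij in jl *; rewrite same //; case: (i \in S) => /=.
    by exists (c i); rewrite // mulrA sqr_e mulr_algl.
  by exists 1; rewrite ?oner_neq0 // scale1r.
have [a an0 aE] := IH ul il; case: (j \in S); last by exists a.
exists (- a); rewrite ?oppr_eq0 //.
by rewrite mulrA anticomm_e // mulNr -mulrA aE scaleNr scalerAr.
Qed.

Lemma monomE S : monom S = \prod_(j <- enum 'I_k | j \in S) e j.
Proof.
rewrite -big_filter /monom; congr bigop; rewrite /enum_mem -filter_predI.
by apply: eq_filter => j; rewrite /= andbT.
Qed.

Lemma e_monom i S : exists2 a : F, a != 0 &
  e i * monom S = a *: monom (symdiff [set i] S).
Proof.
rewrite !monomE; apply: e_prod_insert; rewrite ?enum_uniq //.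
by rewrite mem_enum.
Qed.

Lemma monomM S T : exists2 a : F, a != 0 &
  monom S * monom T = a *: monom (symdiff S T).
Proof.
have symd0 (U : {set 'I_k}) : symdiff [set i in [::]] U = U.
  by apply/setP=> j; rewrite !inE.
have -> : S = [set i in enum S] by apply/setP=> j; rewrite !inE mem_enum.
rewrite {1}/monom (eq_enum (B := S)) => [|j]; last by rewrite !inE mem_enum.
elim: (enum S) (enum_uniq S) => [|i l IH] /=.
  by exists 1; rewrite ?oner_neq0 // big_nil mul1r symd0 scale1r.
move=> /andP[il /IH[a an0 aE]].
have [b bn0 bE] := e_monom i (symdiff [set i in l] T).
exists (a * b); first by rewrite mulf_neq0.
rewrite big_cons -mulrA aE -scalerAr bE scalerA; congr (_ *: monom _).
apply/setP=> j; rewrite !inE addbA; congr (_ (+) _).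
by case: eqVneq => //= ->; rewrite (negPf il).
Qed.

Lemma sqr_prod_e (l : seq 'I_k) :
  exists b : bool, (\prod_(j <- l) e j) * (\prod_(j <- l) e j) =
    ((-1) ^+ b * \prod_(j <- l) c j)%:A.
Proof.
elim: l => [|i l [b IH]]; first by exists false; rewrite !big_nil !mulr1 scale1r.
rewrite !big_cons; set x := \prod_(j <- l) e j in IH *.
set n := count (predC1 i) l; exists (odd n (+) b).
have xe : x * e i = (-1) ^+ n *: (e i * x).
  by rewrite e_prod scalerA -exprMn mulrNN mulr1 expr1n scale1r.
rewrite mulrA -(mulrA (e i)) xe -scalerAr mulrA sqr_e -scalerAl -mulrA IH.
rewrite mulr_algl !scalerA signr_addb signr_odd; congr (_ *: _).
by rewrite mulrACA.
Qed.

Lemma monom_span : spanning monom.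
Proof.
apply: gen_e => [|a x y [u ->] [v ->]|i x [u ->]].
- exists (fun S => if S == set0 then 1 else 0); rewrite (bigD1 set0) //= big1.
    by rewrite eqxx scale1r addr0 monom0.
  by move=> S /negPf ->; rewrite scale0r.
- exists (fun S => a * u S + v S); rewrite scaler_sumr -big_split.
  by apply: eq_bigr => S _; rewrite scalerDl scalerA.
- have [w w0 wE] : exists2 w : {set 'I_k} -> F, forall S, w S != 0 &
      forall S, e i * monom S = w S *: monom (symdiff [set i] S).
    have /choice[w wE] : forall S, exists a, a != 0 /\
        e i * monom S = a *: monom (symdiff [set i] S).
      by move=> S; have [a] := e_monom i S; exists a.
    by exists w => S; have [] := wE S.
  have sK : involutive (symdiff [set i]).
    by move=> S; apply/setP=> j; rewrite !inE addKb.
  exists (fun S => u (symdiff [set i] S) * w (symdiff [set i] S)).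
  rewrite mulr_sumr (reindex_inj (inv_inj sK)) /=; apply: eq_bigr => S _.
  by rewrite -scalerAr wE sK scalerA.
Qed.

(** The second term is the conjugate of x by [e i], whose inverse is (c i)^-1 e_i. The sum doubles
    what the conjugation fixes and kills what it negates. *)
Definition twist i (x : A) : A := x + (c i)^-1 *: (e i * x * e i).
(** This is 2^k times the projection onto the span of the central monomials. *)
Definition proj_center (x : A) : A := foldr twist x (enum 'I_k).

Definition central_set (S : {set 'I_k}) := [forall i, ~~ odd #|S :\ i|].

(** An index inside S forces #|S| to be odd, an index outside S forces it to be even; so both kinds
    cannot occur. *)
Lemma central_setP S : central_set S -> S = set0 \/ odd k /\ S = setT.
Proof.
move=> /forallP cS; case: (set_0Vmem S) => [->|[i iS]]; [by left|right].
have ES j : j \in S.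
  apply: contraT => jS; move: (cS i) (cS j).
  have -> : S :\ j = S.
    by apply/setP=> t; rewrite !inE; case: eqP => //= ->; rewrite (negPf jS).
  by rewrite (cardsD1 i S) iS /= => /negPf ->.
have ST : S = setT by apply/setP=> j; rewrite ES inE.
have Sk : #|S| = k by rewrite ST cardsT card_ord.
by split=> //; rewrite -Sk (cardsD1 i S) iS /= cS.
Qed.

Lemma twist_monom i S :
  twist i (monom S) = if odd #|S :\ i| then 0 else 2%:R *: monom S.
Proof.
rewrite /twist e_monom_comm -scalerAl -mulrA sqr_e mulr_algr !scalerA mulrAC.
rewrite mulVf // mul1r -signr_odd; case: ifP => _.
  by rewrite expr1 scaleN1r subrr.
by rewrite expr0 scale1r scaler_nat.
Qed.

Fact twist_linear i : linear (twist i).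
Proof.
move=> a x y; rewrite /twist mulrDr mulrDl -scalerAr -scalerAl scalerDr.
by rewrite scalerA mulrC -scalerA addrACA -scalerDr.
Qed.
HB.instance Definition _ i := GRing.isLinear.Build F A A _ (twist i)
  (twist_linear i).

Fact proj_center_linear : linear proj_center.
Proof.
rewrite /proj_center => a x y; elim: (enum 'I_k) => //= i l ->.
by rewrite linearP.
Qed.
HB.instance Definition _ := GRing.isLinear.Build F A A _ proj_center
  proj_center_linear.

Lemma proj_center_monom S : proj_center (monom S) =
  if central_set S then (2 ^ k)%:R *: monom S else 0.
Proof.
have -> : central_set S = all (fun i => ~~ odd #|S :\ i|) (enum 'I_k).
  by apply/forallP/allP => [cS i _|cS i]; apply: cS; rewrite ?mem_enum.
rewrite /proj_center -[in (2 ^ k)%N](size_enum_ord k).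
elim: (enum 'I_k) => [|i l IH] /=; first by rewrite scale1r.
rewrite IH; case: (all _ l); rewrite ?andbF ?linear0 // andbT linearZ_LR.
rewrite /= twist_monom if_neg; case: ifP => _; first by rewrite scaler0.
by rewrite scalerA expnSr natrM.
Qed.

Lemma proj_center_ideal (I : A -> Prop) x :
  two_sided_ideal I -> I x -> I (proj_center x).
Proof.
case=> I0 IB IM Ix; rewrite /proj_center; elim: (enum 'I_k) => //= i l Il.
rewrite /twist -[X in I X]opprK opprD.
have IN y : I y -> I (- y) by move=> Iy; rewrite -sub0r; apply: IB.
apply/IN/IB; [exact: IN | rewrite -mulr_algl].
by apply: (IM _ _ _).1; apply: (IM _ _ _).2; apply: (IM _ _ Il).1.
Qed.

Lemma proj_center_central x : (forall y, x * y = y * x) ->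
  proj_center x = (2 ^ k)%:R *: x.
Proof.
move=> cx; rewrite /proj_center -[in (2 ^ k)%N](size_enum_ord k).
elim: (enum 'I_k) => [|i l /= ->]; first by rewrite scale1r.
rewrite linearZ_LR /= /twist -cx -mulrA sqr_e mulr_algr scalerA mulVf // scale1r.
by rewrite -mulr2n -scaler_nat scalerA expnSr natrM.
Qed.

Definition volume := monom setT.

Lemma volume_sqr : exists b : bool,
  volume * volume = ((-1) ^+ b * \prod_i c i)%:A.
Proof.
have [b bE] := sqr_prod_e (enum [set: 'I_k]); exists b; rewrite [LHS]bE.
by congr ((_ * _)%:A); rewrite big_enum; apply: eq_bigl => i; rewrite inE.
Qed.

(** Both signs are covered because [volume_sqr] leaves the sign of the square open. *)
Hypothesis disc_nonsquare : odd k ->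
  forall (b : bool) (a : F), (-1) ^+ b * \prod_i c i <> a ^+ 2.

(** Multiplication by the conjugate u - v z gives the norm u^2 - v^2 z^2; if it vanished with v
    nonzero, z^2 would be the square of u / v. *)
Lemma center_field u v : u != 0 -> odd k \/ v = 0 ->
  exists y : A, y * (u%:A + v *: volume) = 1.
Proof.
move=> un0 kv; have [b zz] := volume_sqr.
pose w := u ^+ 2 - v ^+ 2 * ((-1) ^+ b * \prod_i c i).
have wE : (u%:A - v *: volume) * (u%:A + v *: volume) = w%:A.
  rewrite mulrBl !mulrDr !mulr_algl mulr_algr -!scalerAl -!scalerAr zz.
  rewrite !scalerA -expr2 opprD addrA addrK -scalerBl.
  by rewrite /w expr2 mulrA.
have wn0 : w != 0.
  rewrite subr_eq0; apply/eqP; case: kv => [oddk|->]; last first.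
    by rewrite expr0n mul0r => /eqP; rewrite expf_eq0 (negPf un0).
  case: (eqVneq v 0) => [->|vn0 uv].
    by rewrite expr0n mul0r => /eqP; rewrite expf_eq0 (negPf un0).
  apply: (disc_nonsquare oddk (b := b) (a := u / v)).
  by rewrite exprMn exprVn uv [v ^+ 2 * _]mulrC mulfK // expf_neq0.
exists (w^-1 *: (u%:A - v *: volume)).
by rewrite -scalerAl wE scalerA mulVf // scale1r.
Qed.

Lemma proj_center_sum (a : {set 'I_k} -> F) :
  exists2 v : F, odd k \/ v = 0 &
    proj_center (\sum_S a S *: monom S) =
    ((2 ^ k)%:R * a set0)%:A + v *: volume.
Proof.
have pS S : S != set0 -> S != setT -> proj_center (monom S) = 0.
  move=> S0 ST; rewrite proj_center_monom; case: ifP => // /central_setP[|[_]] SE.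
    by rewrite SE eqxx in S0.
  by rewrite SE eqxx in ST.
rewrite linear_sum (bigD1 set0) //= linearZ_LR /= proj_center_monom monom0.
have -> : central_set set0 by apply/forallP=> i; rewrite set0D cards0.
rewrite scalerA [a _ * _]mulrC.
(* For k = 0 the volume element is the monomial 1, already counted in the first term. *)
case: (eqVneq [set: 'I_k] set0) => [T0|T0].
  exists 0; [by right|]; rewrite scale0r; congr (_ + _).
  by apply: big1 => S S0; rewrite linearZ_LR /= pS ?scaler0 // T0.
rewrite (bigD1 setT) //= linearZ_LR /= proj_center_monom big1 ?addr0; last first.
  by move=> S /andP[S0 ST]; rewrite linearZ_LR /= pS ?scaler0.
case: ifP => [/central_setP[SE|[oddk _]]|_]; first by rewrite SE eqxx in T0.
  by exists (a setT * (2 ^ k)%:R); [left | rewrite scalerA].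
by exists 0; [right | rewrite scaler0 scale0r].
Qed.

Lemma pow2k_neq0 : (2 ^ k)%:R != 0 :> F.
Proof. by rewrite natrX expf_neq0. Qed.

(** Right multiplication by [monom S] permutes the monomials up to nonzero factors and moves the
    S-term to the unit. The projection to the center then leaves u + v z with u nonzero, which is
    invertible by [center_field]. *)
Lemma ideal_monom (I : A -> Prop) (a : {set 'I_k} -> F) S :
  two_sided_ideal I -> I (\sum_T a T *: monom T) -> a S != 0 -> I 1.
Proof.
move=> idI Ix aS; have [_ _ IM] := idI.
have [w wn0 wE] : exists2 w : {set 'I_k} -> F, forall T, w T != 0 &
    forall T, monom T * monom S = w T *: monom (symdiff T S).
  have /choice[w wE] : forall T, exists b, b != 0 /\
      monom T * monom S = b *: monom (symdiff T S).
    by move=> T; have [b] := monomM T S; exists b.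
  by exists w => T; have [] := wE T.
have sK : involutive (symdiff ^~ S).
  by move=> T; apply/setP=> j; rewrite !inE -addbA addbb addbF.
have xS : (\sum_T a T *: monom T) * monom S =
    \sum_T (a (symdiff T S) * w (symdiff T S)) *: monom T.
  rewrite mulr_suml (reindex_inj (inv_inj sK)) /=; apply: eq_bigr => T _.
  by rewrite -scalerAl wE sK scalerA.
have := proj_center_ideal idI (IM (monom S) _ Ix).2; rewrite xS.
have [v kv ->] := proj_center_sum (fun T => a (symdiff T S) * w (symdiff T S)).
have s0S : symdiff set0 S = S by apply/setP=> j; rewrite !inE.
have [|y yE] := @center_field ((2 ^ k)%:R * (a S * w S)) v _ kv.
  by rewrite !mulf_neq0 // pow2k_neq0.
by rewrite s0S => Iz; rewrite -yE; apply: (IM y _ Iz).1.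
Qed.

(** [ideal_monom] for the zero ideal: a nontrivial relation would give 1 = 0. *)
Lemma monom_indep : lin_indep monom.
Proof.
move=> a a0 S; apply/eqP/negP=> /negP aS.
have /eqP[] := oner_neq0 A; apply: (@ideal_monom (fun x => x = 0) a S) => //.
split=> // [x y -> ->|x y ->]; first by rewrite subrr.
by rewrite mulr0 mul0r.
Qed.

Lemma anticomm_has_dim : has_dim A (2 ^ k).
Proof.
have := has_dim_basis monom_indep monom_span.
by rewrite -cardsT -powersetT card_powerset cardsT card_ord.
Qed.

Lemma anticomm_simple : simple_ring A.
Proof.
move=> I idI; have [I0 _ IM] := idI.
case: (pselect (I 1)) => [I1|nI1]; [right=> x|left=> x Ix].
  by rewrite -[x]mulr1; apply: (IM x 1 I1).1.
have [a xE] := monom_span x; rewrite xE in Ix *.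
rewrite big1 // => S _; case: (eqVneq (a S) 0) => [->|aS]; first by rewrite scale0r.
by case: nI1; apply: ideal_monom idI Ix aS.
Qed.

Lemma volume_central y : odd k -> volume * y = y * volume.
Proof.
move=> oddk; apply: (gen_e (P := fun y => volume * y = y * volume)) y.
- by rewrite mulr1 mul1r.
- by move=> a x y xE yE; rewrite mulrDr mulrDl -scalerAr -scalerAl xE yE.
move=> i x xE; rewrite -[RHS]mulrA -xE !mulrA; congr (_ * _).
rewrite e_monom_comm -signr_odd.
have -> : odd #|[set: 'I_k] :\ i| = false; last by rewrite expr0 scale1r.
have cT : #|[set: 'I_k]| = k by rewrite cardsT card_ord.
by apply: negbTE; have := oddk; rewrite -{1}cT (cardsD1 i) inE.
Qed.

Lemma anticomm_center x : (forall y, x * y = y * x) ->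
  exists u v, x = u%:A + v *: volume /\ (odd k \/ v = 0).
Proof.
move=> /proj_center_central; have [a {1}->] := monom_span x.
have [v kv ->] := proj_center_sum a => xE.
exists (a set0), ((2 ^ k)%:R^-1 * v); split; last first.
  by case: kv => [|->]; [left | right; rewrite mulr0].
apply: (scalerI pow2k_neq0); rewrite -xE scalerDr !scalerA mulrA.
by rewrite divff ?pow2k_neq0 ?mul1r.
Qed.

End AnticommutingGenerators.

(** * The discriminant *)

Lemma frac_ratio (D : idomainType) (a : {fraction D}) :
  exists x y : D, y != 0 /\ a = tofrac x / tofrac y.
Proof.
have [r ->] : exists r : {ratio D}, a = (\pi_{fraction D} r)%qT.
  by exists (repr a); rewrite reprK.
exists (frac r).1, (frac r).2; split; first exact: denom_ratioP.
have dn0 : tofrac (frac r).2 != 0 by rewrite tofrac_eq0 denom_ratioP.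
apply: (mulIf dn0); rewrite divfK //.
unlock tofrac; rewrite -[LHS]FracField.pi_mul; apply/eqmodP.
rewrite /= FracField.equivfE /FracField.mulf.
have d0 := denom_ratioP r; have one0 := oner_neq0 D.
rewrite !(numer_Ratio _ one0) !(denom_Ratio _ one0) !mulr1.
by rewrite !(numer_Ratio _ d0) !(denom_Ratio _ d0) mulrC.
Qed.

(** The left side has degree k + 2 deg y, which is odd. The parities compared in the proof are those
    of sizes, one more than degrees. *)
Lemma odd_size_nonsquare (D : idomainType) (c : D) (y x : {poly D}) k :
  odd k -> c != 0 -> y != 0 -> c%:P * 'X^k * y ^+ 2 <> x ^+ 2.
Proof.
move=> oddk c0 y0 E.
have cX0 : c%:P * 'X^k != 0 by rewrite mulf_neq0 ?polyC_eq0 ?monic_neq0 ?monicXn.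
have x0 : x != 0.
  by apply: contraNneq (mulf_neq0 cX0 (expf_neq0 2 y0)) => x0; rewrite E x0 expr0n.
move: (congr1 (fun r : {poly D} => odd (size r)) E).
rewrite size_mul ?expf_neq0 // size_Cmul // size_polyXn !expr2 !size_mul //.
move: y0 x0; rewrite -!size_poly_gt0.
case: (size y) => // s _; case: (size x) => // t _.
by rewrite /= !addnS /= !oddD !addbb oddk.
Qed.

(** * Grading the quotient by a homogeneous prime *)

Section HomogeneousPrime.
Variables (n : nat) (K : fieldType) (q : prime_idealr (mpoly n K)).
Hypothesis homq : homogeneous_ideal q.
Notation D := (quot_domain q).
Notation "'pr'" := (@quot_proj _ q).

(* [p |-> \sum_d (p_d mod q) t^d], with [p_d] the degree [d] component. *)
Definition graded_proj : mpoly n K -> {poly D} :=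
  mmap (polyC \o pr \o @mpolyC n K) (fun i => (pr 'X_i)%:P * 'X).
HB.instance Definition _ := GRing.RMorphism.copy graded_proj
  (mmap (polyC \o pr \o @mpolyC n K) (fun i => (pr 'X_i)%:P * 'X)).

Lemma graded_projE p : graded_proj p =
  \sum_(m <- msupp p) (pr (p@_m *: 'X_[m]))%:P * 'X^(mdeg m).
Proof.
rewrite /graded_proj /mmap; apply: eq_bigr => m _.
have -> : mmap1 (fun i => (pr 'X_i)%:P * 'X) m = (pr 'X_[m])%:P * 'X^(mdeg m).
  rewrite /mmap1 (mpolyXE_id) !rmorph_prod mdegE -prodrXr -big_split /=.
  apply: eq_bigr => i _; rewrite exprMn_comm; last exact: mulrC.
  by rewrite !rmorphXn.
by rewrite -mul_mpolyC (rmorphM (@quot_proj _ q)) polyCM mulrA.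
Qed.

Lemma coef_graded_proj p d : (graded_proj p)`_d = pr (pihomog mdeg d p).
Proof.
rewrite graded_projE pihomogE coef_sum rmorph_sum [RHS]big_mkcond.
apply: eq_bigr => m _; rewrite coefCM coefXn eq_sym.
by case: eqP; rewrite ?mulr1 ?mulr0.
Qed.

Lemma graded_proj1 p : (graded_proj p).[1] = pr p.
Proof.
rewrite graded_projE horner_sum [in RHS](mpolyE p) rmorph_sum.
by apply: eq_bigr => m _; rewrite hornerM hornerC hornerXn expr1n mulr1.
Qed.

(** Homogeneity of q enters here: if p is in q, so are all its components, hence all coefficients
    vanish. Conversely, evaluation at t = 1 recovers the class of p. *)
Lemma graded_proj_eq0 p : (graded_proj p == 0) = (p \in q).
Proof.
rewrite -quot_proj_eq0; apply/eqP/eqP => [p0|p0].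
  by rewrite -graded_proj1 p0 horner0.
apply/polyP=> d; rewrite coef_graded_proj coef0.
by apply/eqP; rewrite quot_proj_eq0; apply: homq; rewrite -[q p]/(p \in q) -quot_proj_eq0 p0.
Qed.

Lemma graded_proj_linear (a : 'I_n -> K) :
  graded_proj (\sum_i a i *: 'X_i) = (pr (\sum_i a i *: 'X_i))%:P * 'X.
Proof.
rewrite !rmorph_sum mulr_suml; apply: eq_bigr => i _.
rewrite -mul_mpolyC !rmorphM /= /graded_proj mmapC mmapX mmap1U /=.
by rewrite mulrA.
Qed.

Lemma graded_proj_det k (M : 'M[mpoly n K]_k) :
    (forall i j, graded_proj (M i j) = (pr (M i j))%:P * 'X) ->
  graded_proj (\det M) = (pr (\det M))%:P * 'X^k.
Proof.
move=> ME; rewrite -(det_map_mx graded_proj).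
have -> : map_mx graded_proj M = 'X *: map_mx polyC (map_mx pr M).
  by apply/matrixP=> i j; rewrite !mxE ME mulrC.
by rewrite detZ mulrC (det_map_mx polyC) (det_map_mx pr).
Qed.

(** Clearing denominators in p = (x / y)^2 puts p y^2 - x^2 in q, and [graded_proj] turns this into
    an equation excluded by [odd_size_nonsquare]. The elements x and y may be inhomogeneous. *)
Lemma homogeneous_odd_nonsquare k p (a : {fraction D}) :
    odd k -> p \notin q -> graded_proj p = (pr p)%:P * 'X^k ->
  tofrac (pr p) <> a ^+ 2.
Proof.
move=> oddk pq pE; have [x [y [yn0 ->]]] := frac_ratio a.
have prS (z : D) : exists w, pr w = z by exists (repr z); apply: reprK.
have [[x' <-] [y' yE]] := (prS x, prS y); rewrite -yE in yn0 *.
have dn0 : tofrac (pr y') ^+ 2 != 0 by rewrite expf_neq0 // tofrac_eq0.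
move=> /(congr1 (fun z => z * tofrac (pr y') ^+ 2)).
rewrite expr_div_n divfK // -!rmorphXn -rmorphM => /eqP.
rewrite tofrac_eq -rmorphM -subr_eq0 -rmorphB quot_proj_eq0 -graded_proj_eq0.
rewrite rmorphB rmorphM !rmorphXn subr_eq0 /= pE.
have Y0 : graded_proj y' != 0 by rewrite graded_proj_eq0 -quot_proj_eq0.
by move/eqP; apply: odd_size_nonsquare; rewrite ?quot_proj_eq0.
Qed.

End HomogeneousPrime.

(** * Symmetric matrices: diagonalization and principal minors *)

Section SymmetricMatrices.
Variable F : fieldType.
Hypothesis two_neq0 : (2%:R : F) != 0.

Lemma sym_mx_diag n (G : 'M[F]_n) : G^T = G ->
  exists2 P, P \in unitmx & exists d, P *m G *m P^T = diag_mx d.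
Proof.
elim: n G => [|n IH] G symG.
  by exists 1%:M; [exact: unitmx1 | exists 0; apply/matrixP=> -[]].
pose f (v : 'rV[F]_n.+1) : F := (v *m G *m v^T) 0 0.
case: (pselect (exists v, f v != 0)); last first.
  move=> nv; suff -> : G = 0.
    exists 1%:M; [exact: unitmx1 | exists 0].
    by rewrite mulmx0 mul0mx; apply/matrixP=> i j; rewrite !mxE mul0rn.
  have qv (v : 'rV[F]_n.+1) : (v *m G *m v^T) 0 0 = 0.
    by apply/eqP/negP=> /negP vn0; apply: nv; exists v.
  pose dl (i : 'I_n.+1) : 'rV[F]_n.+1 := delta_mx 0 i.
  have Gij i j : (dl i *m G *m (dl j)^T) 0 0 = G i j.
    by rewrite /dl trmx_delta -rowE -colE !mxE.
  apply/matrixP=> i j; rewrite [RHS]mxE.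
  (* Polarization: if every vector is isotropic, then 2 G i j = 0. *)
  have := qv (dl i + dl j).
  have E (B C : 'M[F]_1) : (B + C) 0 0 = B 0 0 + C 0 0 by rewrite mxE.
  rewrite linearD /= mulmxDl mulmxDr !mulmxDl !E !qv add0r addr0 !Gij.
  rewrite -{1}symG mxE -mulr2n -mulr_natl => /eqP.
  by rewrite mulf_eq0 (negPf two_neq0) => /eqP.
(* [row_ebase v] is an invertible matrix whose first row is proportional to v, so the corner entry
   of [G1] is nonzero because v is not isotropic. *)
rewrite /f => -[v vn0]; pose U := row_ebase v; pose G1 : 'M_(1 + n) := U *m G *m U^T.
have symG1 : G1^T = G1 by rewrite /G1 !trmx_mul trmxK symG mulmxA.
have G100 : G1 0 0 != 0.
  apply: contraNneq vn0 => G10; pose X : 'rV_(1 + n) := col_ebase v *m pid_mx (\rank v).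
  have XE : X = X 0 0 *: delta_mx 0 0.
    apply/rowP=> j; rewrite [RHS]mxE [delta_mx _ _ _ _]mxE eqxx /=.
    case: (unliftP 0 j) => [i ->|->]; last by rewrite eqxx mulr1.
    by rewrite mulr0 /X mxE big_ord1 mxE mulr0.
  have -> : v = X *m U by rewrite mulmx_ebase.
  rewrite trmx_mul !mulmxA -(mulmxA X) -(mulmxA X) -/G1 XE linearZ /=.
  rewrite -scalemxAl -scalemxAl -scalemxAr trmx_delta -rowE -colE.
  have -> : col 0 (row 0 G1) = 0.
    by apply/matrixP=> i j; rewrite [LHS]mxE [LHS]mxE G10 mxE.
  by rewrite !scaler0 mxE.
pose a := ulsubmx G1; pose b := dlsubmx G1.
have aE : a = (G1 0 0)%:M.
  apply/matrixP=> i j; rewrite !ord1 /a [RHS]mxE eqxx /ulsubmx /usubmx /lsubmx.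
  by rewrite [LHS]mxE [LHS]mxE; congr (G1 _ _); apply: val_inj.
have bT : b^T = ursubmx G1 by rewrite /b trmx_dlsub symG1.
pose Q : 'M_(1 + n) := block_mx 1%:M 0 (- (G1 0 0)^-1 *: b) 1%:M.
have unitQ : Q \in unitmx by rewrite unitmxE det_lblock !det1 mulr1 unitr1.
(* The Schur complement of the corner entry; it is again symmetric, and the induction applies to
   it. *)
pose H := drsubmx G1 - (G1 0 0)^-1 *: (b *m b^T).
have QG : Q *m G1 *m Q^T = block_mx a 0 0 H.
  rewrite -{1}[G1]submxK /Q tr_block_mx -/a -/b -bT !mulmx_block.
  rewrite !mul1mx !mul0mx !addr0 !trmx1 !trmx0 !mulmx1 !mulmx0 !addr0 linearZ /=.
  have ba : - (G1 0 0)^-1 *: b *m a + b = 0.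
    by rewrite aE mul_mx_scalar scalerA mulrN mulfV // scaleN1r addNr.
  rewrite ba mul0mx !add0r; congr block_mx.
    rewrite aE -scalemxAr mul_scalar_mx scalerA mulNr mulVf // scaleN1r.
    exact: addNr.
  by rewrite -scalemxAl scaleNr addrC.
have symH : H^T = H.
  have : (Q *m G1 *m Q^T)^T = Q *m G1 *m Q^T.
    by rewrite (trmx_mul (Q *m G1)) (trmx_mul Q) trmxK symG1 mulmxA.
  by rewrite QG tr_block_mx => /eq_block_mx[].
have [P' unitP' [d' dE]] := IH H symH.
pose P1 : 'M_(1 + n) := block_mx 1%:M 0 0 P'.
exists (P1 *m Q *m U).
  have unitP1 : P1 \in unitmx by rewrite unitmxE det_ublock det1 mul1r -unitmxE.
  by rewrite unitmx_mul row_ebase_unit andbT unitmx_mul unitP1.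
exists (row_mx (G1 0 0)%:M d').
have -> : P1 *m Q *m U *m G *m (P1 *m Q *m U)^T =
    P1 *m (Q *m G1 *m Q^T) *m P1^T by rewrite /G1 !trmx_mul !mulmxA.
rewrite QG tr_block_mx !mulmx_block.
rewrite !trmx1 !trmx0 !(mul1mx, mul0mx, mulmx0, mulmx1, addr0, add0r) dE aE.
apply/matrixP=> i j; rewrite /block_mx /col_mx !mxE.
have -> : (i == j) = (val i == val j) by rewrite val_eqE.
case: splitP => i' /= ->; rewrite !mxE; case: splitP => j' /= ->; rewrite !mxE.
- by rewrite !ord1 !eqxx.
- by rewrite ltn_eqF // (leq_trans (ltn_ord i')) // leq_addr.
- by rewrite gtn_eqF // (leq_trans (ltn_ord j')) // leq_addr.
- by rewrite eqn_add2l.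
Qed.

(** Let S select k rows of G that span its row space, so that G = T S G. By symmetry also G = G S^T
    T^T, whence G = T (S G S^T) T^T, and S G S^T is a principal submatrix. One choice of rows serves
    every [u]. *)
Lemma sym_mx_principal_minor m k (G : 'M[F]_m) : G^T = G -> \rank G = k ->
  exists h : 'I_k -> 'I_m, forall u : 'M_(k, m), exists t : F,
    \det (u *m G *m u^T) = t ^+ 2 * \det (mxsub h h G).
Proof.
move=> symG rkG.
have [h [T GT]] : exists (h : 'I_k -> 'I_m) (T : 'M_(m, k)), G = T *m rowsub h G.
  case: k / rkG; exists (maxrankfun G).
  by apply/submxP; rewrite eq_maxrowsub.
exists h => u; exists (\det (u *m T)).
pose S : 'M[F]_(k, m) := rowsub h 1%:M.
have SG : rowsub h G = S *m G by rewrite rowsubE.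
have minorE : mxsub h h G = S *m G *m S^T.
  rewrite -SG; apply/matrixP=> i j; rewrite !mxE (bigD1 (h j)) //=.
  rewrite !mxE eqxx mulr1 big1 ?addr0 // => l lj.
  by rewrite !mxE eq_sym (negPf lj) mulr0.
rewrite SG in GT.
have GT' : G = G *m S^T *m T^T by rewrite -{1}symG {1}GT !trmx_mul symG.
have GE : u *m G *m u^T = (u *m T) *m (S *m G *m S^T) *m (u *m T)^T.
  by rewrite {1}GT {1}GT' trmx_mul !mulmxA.
by rewrite GE minorE !det_mulmx det_tr expr2 mulrAC.
Qed.
End SymmetricMatrices.

Section GramMatrix.
Variables (F : fieldType) (V : vectType F) (B : V -> V -> F).
Hypotheses (symB : forall u v, B u v = B v u)
  (linB : forall u, linear (B u : V -> F^o)).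

Definition gram_mx n (e : n.-tuple V) : 'M[F]_n := \matrix_(i, j) B e`_i e`_j.

Lemma gram_mx_sym n (e : n.-tuple V) : (gram_mx e)^T = gram_mx e.
Proof. by apply/matrixP=> i j; rewrite !mxE symB. Qed.

Lemma form_sumr n (e : n.-tuple V) u (y : 'I_n -> F) :
  B u (\sum_j y j *: e`_j) = \sum_j y j * B u e`_j.
Proof.
pose B' : {linear V -> F^o} :=
  HB.pack (B u : V -> F^o) (GRing.isLinear.Build F V F^o _ (B u) (linB u)).
rewrite -[LHS]/(B' _) linear_sum; apply: eq_bigr => j _.
exact: linearZ_LR.
Qed.

Lemma gram_mxE n (e : n.-tuple V) (x y : 'rV[F]_n) :
  B (\sum_i x 0 i *: e`_i) (\sum_j y 0 j *: e`_j) = (x *m gram_mx e *m y^T) 0 0.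
Proof.
rewrite form_sumr mxE; apply: eq_bigr => j _; rewrite symB form_sumr mulrC !mxE.
by congr (_ * _); apply: eq_bigr => i _; rewrite mxE symB.
Qed.

Lemma gram_mx_det_neq0 n (e : n.-tuple V) :
    (forall u, (forall v, B u v = 0) -> u = 0) -> basis_of fullv e ->
  \det (gram_mx e) != 0.
Proof.
move=> ndB be; rewrite -unitfE -[_ \is a _]/(gram_mx e \in unitmx) -row_free_unit.
apply: inj_row_free => x x0.
have /ndB w0 v : B (\sum_i x 0 i *: e`_i) v = 0.
  rewrite (coord_basis be (memvf v)).
  have := gram_mxE e x (\row_j coord e j v); rewrite x0 mul0mx mxE => <-.
  by congr B; apply: eq_bigr => j _; rewrite mxE.
by apply/rowP=> i; rewrite mxE; have /freeP := basis_free be; apply.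
Qed.

End GramMatrix.

(** * Clifford algebra of a nondegenerate symmetric form *)

Section CliffordStructure.
Variables (F : fieldType) (V : vectType F) (B : V -> V -> F).
Hypotheses (symB : forall u v, B u v = B v u)
  (linB : forall u, linear (B u : V -> F^o)).
Variables (A : algType F) (iota : {linear V -> A}).
Hypothesis iota_rel : forall u v,
  iota u * iota v + iota v * iota u = (B u v)%:A.
Hypothesis iota_gen : forall P : A -> Prop, P 1 ->
  (forall a x y, P x -> P y -> P (a *: x + y)) ->
  (forall v x, P x -> P (iota v * x)) -> forall x, P x.
Hypothesis two_neq0 : (2%:R : F) != 0.
Variables (ii s2 : F).
Hypotheses (ii2 : ii ^+ 2 = -1) (s22 : s2 ^+ 2 = 2%:R).
Variables (n : nat) (e : n.-tuple V).
Hypotheses (be : basis_of fullv e) (det_neq0 : \det (gram_mx B e) != 0).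
Hypothesis det_nonsquare : odd n -> forall a, \det (gram_mx B e) <> a ^+ 2.

(* As [-1] and [2] are squares in [F], the square of the product of an
   orthogonal basis agrees with [\det (gram_mx B e)] up to a square. *)
Lemma clifford_structure : exists z : A,
  [/\ has_dim A (2 ^ n), simple_ring A,
      odd n -> z * z = (\det (gram_mx B e))%:A /\ forall y, z * y = y * z &
      forall x, (forall y, x * y = y * x) ->
        exists u v, x = u%:A + v *: z /\ (odd n \/ v = 0)].
Proof.
have [P unitP [d PG]] := sym_mx_diag two_neq0 (gram_mx_sym symB e).
pose f i := \sum_j P i j *: e`_j; pose E i := iota (f i).
(* With the relation uv + vu = B(u, v), the square of a generator is half the value of the form. *)
pose c i := d 0 i / 2%:R.
have Bf i j : B (f i) (f j) = d 0 i *+ (i == j).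
  have fE k : f k = \sum_j (row k P) 0 j *: e`_j.
    by apply: eq_bigr => l _; rewrite mxE.
  rewrite !fE gram_mxE // tr_row -row_mul.
  transitivity ((P *m gram_mx B e *m P^T) i j); last by rewrite PG !mxE.
  by rewrite !mxE; apply: eq_bigr => l _; rewrite !mxE.
have detd : \det P ^+ 2 * \det (gram_mx B e) = \prod_i d 0 i.
  by rewrite -det_diag -PG !det_mulmx det_tr expr2 mulrAC.
have dn0 i : d 0 i != 0.
  have : \prod_i d 0 i != 0.
    by rewrite -detd mulf_neq0 // expf_neq0 // -unitfE.
  by move/prodf_neq0; apply.
have cn0 i : c i != 0 by rewrite mulf_neq0 ?invr_eq0.
have sqrE i : E i * E i = (c i)%:A.
  have := iota_rel (f i) (f i); rewrite Bf eqxx -mulr2n -scaler_nat => H.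
  by apply: (scalerI two_neq0); rewrite H scalerA mulrC divfK.
have antiE i j : i != j -> E i * E j = - (E j * E i).
  move=> ij; have := iota_rel (f i) (f j); rewrite Bf (negPf ij) scale0r.
  by move/eqP; rewrite addr_eq0 => /eqP.
have genE : forall Q : A -> Prop, Q 1 ->
    (forall a x y, Q x -> Q y -> Q (a *: x + y)) ->
    (forall i x, Q x -> Q (E i * x)) -> forall x, Q x.
  move=> Q Q1 Ql Qm; apply: iota_gen => // v x Qx.
  have Q0 : Q 0 by have := Ql (-1) 1 1 Q1 Q1; rewrite scaleN1r addNr.
  have [y ->] : exists y : 'I_n -> F, v = \sum_i y i *: f i.
    pose w := \row_j coord e j v.
    exists (fun i => (w *m invmx P) 0 i); rewrite {1}(coord_basis be (memvf v)).
    transitivity (\sum_j (w *m invmx P *m P) 0 j *: e`_j).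
      by apply: eq_bigr => j _; rewrite mulmxKV // mxE.
    rewrite /f; under [RHS]eq_bigr do rewrite scaler_sumr.
    rewrite exchange_big; apply: eq_bigr => j _; rewrite mxE scaler_suml.
    by apply: eq_bigr => i _; rewrite scalerA.
  rewrite linear_sum mulr_suml; elim: (index_enum _) => [|i l IH].
    by rewrite big_nil.
  by rewrite big_cons linearZ_LR -scalerAl; apply: Ql => //; apply: Qm.
have s2n0 : s2 != 0.
  by apply: contraNneq two_neq0 => s0; rewrite -s22 s0 expr0n.
have iin0 : ii != 0.
  by apply: contraNneq (oner_neq0 F) => i0; rewrite -[1]opprK -ii2 i0 expr0n oppr0.
(* The three factors account for the sign, the change to an orthogonal basis, and the n halves in
   the [c i]. *)
pose r (b : bool) := ii ^+ b * \det P / s2 ^+ n.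
have rn0 b : r b != 0.
  by rewrite !mulf_neq0 ?invr_eq0 ?expf_neq0 // -unitfE.
have discE (b : bool) : (-1) ^+ b * \prod_i c i = r b ^+ 2 * \det (gram_mx B e).
  have -> : \prod_i c i = (\prod_i d 0 i) / 2%:R ^+ n.
    by rewrite big_split prodr_const card_ord /= exprVn.
  rewrite -detd /r !exprMn exprVn (exprAC ii) (exprAC s2) ii2 s22.
  by rewrite !mulrA [LHS]mulrAC.
have nonsq : odd n -> forall (b : bool) (a : F), (-1) ^+ b * \prod_i c i <> a ^+ 2.
  move=> oddn b a; rewrite discE => ra; apply: (det_nonsquare oddn (a := a / r b)).
  by rewrite exprMn exprVn -ra mulrAC mulfV ?mul1r // expf_neq0.
have [b zz] := volume_sqr sqrE antiE.
(* The rescaling makes the square equal to the Gram determinant itself, so that a given square root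
   of that determinant can be mapped to z. *)
exists ((r b)^-1 *: volume E); split.
- exact: (anticomm_has_dim two_neq0 cn0 sqrE antiE genE nonsq).
- exact: (anticomm_simple two_neq0 cn0 sqrE antiE genE nonsq).
- move=> oddn; split=> [|y].
    rewrite -scalerAl -scalerAr zz discE !scalerA; congr (_ *: _).
    by rewrite mulrA -expr2 -exprMn mulVf // expr1n mul1r.
  by rewrite -scalerAl -scalerAr (volume_central antiE genE).
move=> x /(anticomm_center two_neq0 cn0 sqrE antiE genE)[u [v [-> nv]]].
exists u, (v * r b); rewrite scalerA mulfK //; split=> //.
by case: nv => [|->]; [left | right; rewrite mul0r].
Qed.

End CliffordStructure.

(** * Quadratic extensions *)

Lemma dim_even k N d : ~~ odd k -> (0 < d)%N -> (2 ^ k = N * N * d)%N ->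
  (2 ^ k./2 <= N * d)%N /\ ((N * d)%N = (2 ^ k./2)%N <-> d = 1%N).
Proof.
move=> evk d0 kE; set X := (2 ^ k./2)%N.
have XX : (X * X = N * N * d)%N.
  by rewrite -kE /X -expnD addnn even_halfK.
have X0 : (0 < X * X)%N by rewrite muln_gt0 !expn_gt0.
have E : (N * d * (N * d) = X * X * d)%N by rewrite XX mulnACA mulnA.
split; first by rewrite -leq_sqr -!mulnn E leq_pmulr.
split=> [NX|d1]; last by apply/eqP; rewrite -eqn_sqr -!mulnn E d1 muln1.
by apply/eqP; rewrite -(eqn_pmul2l X0) -E NX muln1.
Qed.

Lemma dim_odd k a d : odd k -> (2 ^ k = 2 ^ a * 2 ^ a * d)%N ->
  (2 ^ k.+1./2 <= 2 ^ a * d)%N /\ ((2 ^ a * d)%N = (2 ^ k.+1./2)%N <-> d = 2%N).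
Proof.
move=> oddk kE; set X := (2 ^ k.+1./2)%N.
have XX : (X * X = 2 ^ a * 2 ^ a * d * 2)%N.
  by rewrite -kE /X -expnD addnn even_halfK ?expnSr //= oddk.
have X0 : (0 < X * X)%N by rewrite muln_gt0 !expn_gt0.
(* d = 0 would make a power of 2 vanish, and d = 1 would give k = 2 a, against the parity of k. *)
have d2 : (2 <= d)%N.
  case: d kE {XX} => [|[|//]]; rewrite ?muln0 ?muln1 => /eqP.
    by rewrite expn_eq0.
  by rewrite -expnD addnn eqn_exp2l // => /eqP kE; rewrite kE odd_double in oddk.
have E : (2 ^ a * d * (2 ^ a * d) * 2 = X * X * d)%N.
  by rewrite XX mulnACA -!mulnA; congr (_ * (_ * (_ * _)))%N; rewrite mulnC.
split; first by rewrite -leq_sqr -!mulnn -(leq_pmul2r (m := 2)) // E leq_pmul2l.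
have B : ((2 ^ a * d)%N == X) = (d == 2%N).
  by rewrite -eqn_sqr -!mulnn -(eqn_pmul2r (m := 2)) // E eqn_pmul2l.
by split=> /eqP; [rewrite B | rewrite -B] => /eqP.
Qed.

Section AdjoinSqrt.
Variables (F : fieldType) (dl : F) (K : fieldExtType F) (s : K).
Hypotheses (nonsq : forall a, dl <> a ^+ 2) (s2 : s ^+ 2 = dl%:A)
  (gen_s : <<1; s>>%VS = fullv).

Lemma adjoin_sqrt_span (x : K) : exists u v : F, x = u%:A + v *: s.
Proof.
have powE i : exists u v : F, s ^+ i = u%:A + v *: s.
  elim: i => [|i [u [v IH]]]; first by exists 1, 0; rewrite scale0r addr0 scale1r.
  exists (v * dl), u; rewrite exprSr IH mulrDl mulr_algl -scalerAl -expr2 s2.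
  by rewrite scalerA addrC.
have /Fadjoin_polyP[p pP ->] : x \in <<1; s>>%VS by rewrite gen_s memvf.
rewrite horner_coef; elim/big_ind: _ => [|_ _ [u [v ->]] [u' [v' ->]]|i _].
- by exists 0, 0; rewrite !scale0r addr0.
- by exists (u + u'), (v + v'); rewrite !scalerDl addrACA.
- have /polyOverP/(_ i)/vlineP[c ->] := pP; have [u [v ->]] := powE i.
  by exists (c * u), (c * v); rewrite mulr_algl scalerDr !scalerA.
Qed.

Lemma adjoin_sqrt_indep u v : u%:A + v *: s = 0 -> u = 0 /\ v = 0.
Proof.
move=> uv0; case: (eqVneq v 0) uv0 => [->|vn0 uv0].
  by rewrite scale0r addr0 => /eqP; rewrite scaler_eq0 oner_eq0 orbF => /eqP.
case: (nonsq (a := - (u / v))).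
have sE : s = (- (u / v))%:A.
  apply: (scalerI vn0); apply/eqP; rewrite scalerA mulrN mulrC divfK // scaleNr.
  by rewrite -addr_eq0 addrC uv0.
apply/eqP; rewrite -subr_eq0.
have /eqP : (dl - (- (u / v)) ^+ 2) *: (1 : K) = 0.
  by rewrite scalerBl -s2 sE expr2 mulr_algl scalerA -expr2 subrr.
by rewrite scaler_eq0 oner_eq0 orbF.
Qed.

Lemma adjoin_sqrt_inj u v u' v' :
  u%:A + v *: s = u'%:A + v' *: s -> u = u' /\ v = v'.
Proof.
move=> /eqP; rewrite -subr_eq0 opprD addrACA -!scalerBl => /eqP.
by case/adjoin_sqrt_indep=> /eqP + /eqP; rewrite !subr_eq0 => /eqP -> /eqP ->.
Qed.

Lemma adjoin_sqrt_dim : has_dim K 2.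
Proof.
rewrite -card_bool; pose e (b : bool) : K := if b then s else 1.
have E (x : bool -> F) : \sum_b x b *: e b = (x false)%:A + x true *: s.
  by rewrite big_bool addrC.
apply: (@has_dim_basis _ _ _ e) => [x|x].
  by rewrite E => /adjoin_sqrt_indep[? ?] [].
have [u [v ->]] := adjoin_sqrt_span x.
by exists (fun b => if b then v else u); rewrite E.
Qed.

Lemma adjoin_sqrt_lift (A : algType F) (z : A) : z * z = dl%:A ->
  exists f : {lrmorphism K -> A}, forall u v, f (u%:A + v *: s) = u%:A + v *: z.
Proof.
move=> zz; have [a aE] := choice adjoin_sqrt_span.
have [b bE] := choice aE.
pose f x := (a x)%:A + b x *: z.
have fE u v : f (u%:A + v *: s) = u%:A + v *: z.
  have [au bv] := adjoin_sqrt_inj (esym (bE (u%:A + v *: s))).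
  by rewrite /f au bv.
have flin : linear f.
  move=> c x y; rewrite (bE x) (bE y) scalerDr !scalerA addrACA -!scalerDl !fE.
  by rewrite scalerDr !scalerA !scalerDl addrACA.
have fmon : monoid_morphism f.
  split=> [|x y].
    by have := fE 1 0; rewrite !scale0r !addr0 !scale1r.
  rewrite (bE x) (bE y).
  set u := a x; set v := b x; set u' := a y; set v' := b y.
  (* The multiplication rule depends only on the square of w; it is used for s in [K] and for z in
     [A]. *)
  have mulE (B : algType F) (w : B) : w * w = dl%:A ->
      (u%:A + v *: w) * (u'%:A + v' *: w) =
      (u * u' + v * v' * dl)%:A + (u * v' + v * u') *: w.
    move=> ww; rewrite mulrDl !mulrDr !mulr_algl mulr_algr -scalerAl -scalerAr.
    rewrite ww !scalerA !scalerDl -!addrA; congr (_ + _).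
    by rewrite addrA addrC (mulrC v u').
  by rewrite mulE -?expr2 // !fE mulE.
pose f1 := GRing.isLinear.Build F K A _ f flin.
pose f2 := GRing.isMonoidMorphism.Build K A f fmon.
by exists (HB.pack_for {lrmorphism K -> A} f f1 f2).
Qed.

End AdjoinSqrt.

Lemma central_simple_in_alg (F : fieldType) (A : algType F) n :
    has_dim A n -> simple_ring A ->
    (forall x : A, (forall y, x * y = y * x) -> exists u, x = u%:A) ->
  central_simple (in_alg A).
Proof.
move=> dA simpleA cA; split=> // [x|].
  split=> [/cA//|[u ->] y]; by rewrite /= mulr_algl mulr_algr.
have hlin : linear (id : A -> restrict_scalars (in_alg A) A^o).
  by move=> c x y; rewrite -[c *: x in LHS]mulr_algl.
pose h : {linear A -> restrict_scalars (in_alg A) A^o} :=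
  HB.pack (id : A -> restrict_scalars (in_alg A) A^o)
    (GRing.isLinear.Build F A _ _ _ hlin).
exists n; apply: (has_dim_iso (h := h)) dA => // w.
by exists w.
Qed.

(** A family independent over [K] is independent over [F], so the dimension over [F] bounds its
    size. *)
Lemma central_simple_ext (F : fieldType) (K : fieldExtType F) (A : algType F)
    (f : {lrmorphism K -> A}) n :
    has_dim A n -> simple_ring A ->
    (forall x : A, (forall y, x * y = y * x) <-> exists c, x = f c) ->
  central_simple f.
Proof.
move=> dA simpleA cA; split=> //; apply: (bounded_has_dim (m := n)) => I e ie.
apply: (lin_indep_leq (e := e : I -> A) dA) => x x0 i.
have /(_ i)/eqP : forall i, (x i)%:A = 0 :> K.
  apply: ie; rewrite -[RHS]x0; apply: eq_bigr => j _.
  rewrite -[LHS]/(f (x j)%:A * (e j : A)) linearZ_LR /= rmorph1.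
  by rewrite mulr_algl.
by rewrite scaler_eq0 oner_eq0 orbF => /eqP.
Qed.

Lemma alg_iso_dim (F : fieldType) (A B : algType F) m n :
  alg_iso A B -> has_dim A m -> has_dim B n -> m = n.
Proof.
move=> [f [g fK gK]] dA; apply: has_dim_unique.
apply: (has_dim_iso (h := f)) dA => [|w]; first exact: can_inj fK.
by exists (g w); apply: gK.
Qed.

Lemma alg_iso_ext (F : fieldType) (K : fieldExtType F) (D : algType F) m
    (f : {lrmorphism K -> D}) :
  has_dim K m -> has_dim D m -> alg_iso K D.
Proof.
move=> dK dD; exists f.
have fI : injective f.
  apply: raddf_inj => x fx0; apply/eqP/negP=> /negP xn0.
  have /eqP[] := oner_neq0 D.
  by rewrite -(rmorph1 f) -(mulfV xn0) rmorphM fx0 mul0r.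
have fS := linear_inj_surj fI dK dD.
have [g gK] := choice fS; exists g => // x.
by apply: fI; rewrite gK.
Qed.

Lemma alg_iso_base (F : fieldType) (D : algType F) d :
  has_dim D d -> alg_iso F^o D <-> d = 1%N.
Proof.
move=> dD; have dF : has_dim (F^o : lmodType F) 1.
  rewrite -card_unit; apply: (@has_dim_basis _ _ _ (fun _ : unit => 1 : F^o)).
    move=> x; rewrite (bigD1 tt) //= big1 ?addr0 => [|[] //].
    by rewrite -[_ *: _]/(_ * _) mulr1 => x0 [].
  move=> v; exists (fun=> v); rewrite (bigD1 tt) //= big1 ?addr0 => [|[] //].
  by rewrite -[_ *: _]/(_ * _) mulr1.
split=> [/alg_iso_dim iso|d1]; first by rewrite (iso 1%N d).
pose f (c : F^o) : D := c%:A.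
have flin : linear f by move=> c x y; rewrite /f scalerDl scalerA.
have fmon : monoid_morphism f.
  by split=> [|x y]; rewrite /f ?scale1r // mulr_algl scalerA.
pose f1 := GRing.isLinear.Build F F^o D _ f flin.
pose f2 := GRing.isMonoidMorphism.Build F^o D f fmon.
pose f' : {lrmorphism F^o -> D} := HB.pack_for {lrmorphism F^o -> D} f f1 f2.
exists f'; have fI : injective f'.
  move=> x y /eqP; rewrite -subr_eq0 -[f' x]/(x *: 1) -[f' y]/(y *: 1) -scalerBl.
  by rewrite scaler_eq0 oner_eq0 orbF subr_eq0 => /eqP.
rewrite d1 in dD; have [g gK] := choice (linear_inj_surj fI dF dD).
by exists g => // x; apply: fI; rewrite gK.
Qed.

(** The image of [f c] commutes with all matrix units, hence is a scalar matrix; its diagonal entry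
    defines the map to [D]. *)
Lemma central_lift (F : fieldType) (A D K : algType F) (N : nat)
    (f : {lrmorphism K -> A}) :
    matrix_iso A N D -> (forall c y, f c * y = y * f c) ->
  inhabited {lrmorphism K -> D}.
Proof.
move=> isoD cf; pose i0 := Ordinal (matrix_iso_gt0 isoD).
have [M [[M' _ M'K] MF]] := isoD.
have MD x y : M (x + y) = M x + M y by exact: rmorphD.
have MM x y : M (x * y) = M x *m M y by exact: rmorphM.
pose h x : D := M (f x) i0 i0.
have hE x : M (f x) = (h x)%:M.
  apply/matrixP=> j i.
  have /matrixP/(_ j i0) : M (f x) *m delta_mx i i0 = delta_mx i i0 *m M (f x).
    by rewrite -{1 2}[delta_mx i i0]M'K -!MM cf.
  rewrite !mxE (bigD1 i) //= big1 => [|l li]; last by rewrite mxE (negPf li) mulr0.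
  rewrite mxE !eqxx mulr1 addr0 => ->.
  rewrite (bigD1 i0) //= big1 => [|l li]; last by rewrite mxE (negPf li) andbF mul0r.
  by rewrite mxE eqxx andbT addr0 /h; case: eqP; rewrite ?mul1r ?mul0r.
have hlin : linear h.
  move=> c x y; rewrite /h linearP MD -mulr_algl MM MF mul_scalar_mx !mxE.
  by rewrite mulr_algl.
have hmon : monoid_morphism h.
  split=> [|x y]; first by rewrite /h rmorph1 (rmorph1 M) mxE eqxx.
  by rewrite {1}/h rmorphM MM !hE -scalar_mxM mxE eqxx.
pose f1 := GRing.isLinear.Build F K D _ h hlin.
pose f2 := GRing.isMonoidMorphism.Build K D h hmon.
by exists; exact: (HB.pack_for {lrmorphism K -> D} h f1 f2).
Qed.

Lemma wedderburn_pow2 (F : fieldType) (A : algType F) k :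
    has_dim A (2 ^ k) -> simple_ring A ->
  exists (a : nat) (D : algType F), division_ring D /\ matrix_iso A (2 ^ a) D.
Proof.
move=> dA simpleA; have [N [D [divD isoD]]] := wedderburn dA simpleA.
have [M [[M' MK M'K] MF]] := isoD.
have [d dD] := has_dim_entries MK M'K MF (Ordinal (matrix_iso_gt0 isoD)) dA.
have dE := has_dim_unique dA (has_dim_matrix_iso MK M'K MF dD).
have /(dvdn_pfactor _ _ (isT : prime 2))[a _ NE] : (N %| 2 ^ k)%N.
  by rewrite dE -mulnA dvdn_mulr.
by exists a, D; rewrite -NE.
Qed.

Section SimpleModule.
Variables (F : fieldType) (A : algType F) (L : lmodType A) (k : nat).
Hypotheses (dA : has_dim A (2 ^ k)) (simpleA : simple_ring A)
  (simpleL : simple_module L).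

(** One decomposition supplies n and the bound. Any other decomposition computes the dimension of
    the same L, so uniqueness of dimension transfers the criterion to it. *)
Lemma simple_module_even : ~~ odd k ->
  exists n : nat, has_dim (restrict_scalars (in_alg A) L) n /\
    (2 ^ k./2 <= n)%N /\
    forall (a : nat) (D : algType F),
      division_ring D -> matrix_iso A (2 ^ a) D ->
      (n = (2 ^ k./2)%N <-> alg_iso F^o D).
Proof.
move=> evk; have [a0 [D0 [divD0 isoD0]]] := wedderburn_pow2 dA simpleA.
have [d0 [d0gt0 _ d0E dL]] := matrix_iso_dim dA divD0 isoD0 simpleL.
exists (2 ^ a0 * d0)%N; split=> //.
split; first by have [] := dim_even evk d0gt0 d0E.
move=> a D divD isoD.
have [d [dgt0 dD dE dL']] := matrix_iso_dim dA divD isoD simpleL.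
rewrite (has_dim_unique dL dL') (alg_iso_base dD).
by have [] := dim_even evk dgt0 dE.
Qed.

Lemma simple_module_odd : odd k ->
  exists n : nat, has_dim (restrict_scalars (in_alg A) L) n /\
    (2 ^ k.+1./2 <= n)%N /\
    forall (a : nat) (D : algType F),
      division_ring D -> matrix_iso A (2 ^ a) D ->
      exists2 d, has_dim D d & (n = (2 ^ k.+1./2)%N <-> d = 2%N).
Proof.
move=> oddk; have [a0 [D0 [divD0 isoD0]]] := wedderburn_pow2 dA simpleA.
have [d0 [_ _ d0E dL]] := matrix_iso_dim dA divD0 isoD0 simpleL.
exists (2 ^ a0 * d0)%N; split=> //; split; first by have [] := dim_odd oddk d0E.
move=> a D divD isoD.
have [d [_ dD dE dL']] := matrix_iso_dim dA divD isoD simpleL.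
by exists d; rewrite // (has_dim_unique dL dL'); have [] := dim_odd oddk dE.
Qed.

End SimpleModule.

Section QuadraticCenter.
Variables (F : fieldType) (A : algType F) (m : nat) (dl : F) (z : A).
Variable K : fieldExtType F.
Hypotheses (dA : has_dim A m) (simpleA : simple_ring A).
Hypotheses (zz : z * z = dl%:A) (cz : forall y, z * y = y * z).
Hypothesis nonsq : forall a, dl <> a ^+ 2.
Hypothesis adjK : adjoins_sqrt dl K.

Let central_ext : exists2 f : {lrmorphism K -> A},
  (forall c y, f c * y = y * f c) & forall u v, exists c, f c = u%:A + v *: z.
Proof.
have [s [s2 gen_s]] := adjK; have [f fE] := adjoin_sqrt_lift nonsq s2 gen_s zz.
exists f => [c y|u v]; last by exists (u%:A + v *: s).
have [u [v ->]] := adjoin_sqrt_span s2 gen_s c.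
by rewrite fE mulrDl mulrDr mulr_algl mulr_algr -scalerAl -scalerAr cz.
Qed.

Lemma quadratic_center :
    (forall x : A, (forall y, x * y = y * x) -> exists u v, x = u%:A + v *: z) ->
  exists f : {lrmorphism K -> A}, central_simple f.
Proof.
move=> cA; have [f cf fE] := central_ext; exists f.
apply: central_simple_ext dA simpleA _ => x; split=> [/cA[u [v ->]]|[c ->] //].
by have [c <-] := fE u v; exists c.
Qed.

(** [central_lift] maps [K] into [D]; a map from a field to a nonzero ring is injective, hence
    bijective when both dimensions are 2. *)
Lemma quadratic_center_iso N (D : algType F) d :
  matrix_iso A N D -> has_dim D d -> d = 2%N <-> alg_iso K D.
Proof.
move=> isoD dD; have [s [s2 gen_s]] := adjK.
have dK := adjoin_sqrt_dim nonsq s2 gen_s.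
split=> [d2|iso]; last exact/esym/(alg_iso_dim iso dK dD).
have [f cf _] := central_ext; have [h] := central_lift isoD cf.
by apply: (alg_iso_ext h dK); rewrite -d2.
Qed.

End QuadraticCenter.

(** * The Clifford algebra of the bracket *)

Section CliffordGenerators.
Variables (F : fieldType) (V : lmodType F) (B : V -> V -> F).

Definition clifford_gen (v : V) : clifford B := clifford_proj B (free_gen v).

Lemma clifford_gen_linear : linear clifford_gen.
Proof.
have add u v : clifford_gen (u + v) = clifford_gen u + clifford_gen v.
  rewrite /clifford_gen -clifford_projD; apply/clifford_proj_eq.
  exact: (clifford_ideal_rel (Clifford_add B u v)).
have scale a v : clifford_gen (a *: v) = clifford_scale a (clifford_gen v).
  rewrite /clifford_gen -clifford_projZ; apply/clifford_proj_eq.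
  exact: (clifford_ideal_rel (Clifford_scale B a v)).
by move=> a u v; rewrite add scale.
Qed.

Lemma clifford_gen_anticomm u v :
  clifford_gen u * clifford_gen v + clifford_gen v * clifford_gen u
    = B u v *: (1 : clifford B).
Proof.
rewrite -[LHS]/(clifford_mul (clifford_gen u) (clifford_gen v) +
  clifford_mul (clifford_gen v) (clifford_gen u)).
rewrite -[RHS]/(clifford_scale (B u v) (clifford_proj B 1)).
rewrite -!clifford_projM -clifford_projZ -clifford_projD; apply/clifford_proj_eq.
exact: (clifford_ideal_rel (Clifford_anticomm B u v)).
Qed.

(** Words are built by left multiplication with generators, and the free algebra is spanned by
    words. *)
Lemma clifford_gen_ind (P : clifford B -> Prop) : P 1 ->
    (forall a x y, P x -> P y -> P (a *: x + y)) ->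
    (forall v x, P x -> P (clifford_gen v * x)) ->
  forall x, P x.
Proof.
move=> P1 Pl Pm x; rewrite -[x]clifford_reprK; move: (clifford_repr x) => {x} t.
have P0 : P 0 by have := Pl (-1) 1 1 P1 P1; rewrite scaleN1r addNr.
have Pw (s : seq V) : P (clifford_proj B (mkmalgU (FMonom s) 1)).
  elim: s => [|v s IH].
    by rewrite -fmoneE; apply: P1.
  have -> : FMonom (v :: s) = fmmul (fmu v) (FMonom s) by rewrite fmmulE fmuE.
  have := Pm v _ IH; rewrite -[clifford_gen v * _]/(clifford_mul (clifford_gen v) _).
  by rewrite -clifford_projM malgM_def fgmulUU mulr1.
rewrite [t]monalgE; elim/big_rec: _ => [|m y _ IH].
  by rewrite clifford_proj0.
rewrite clifford_projD.
have -> : mkmalgU m (monalg.mcoeff m t) = monalg.mcoeff m t *: mkmalgU m 1.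
  by apply/malgP=> k; rewrite monalg.mcoeffZ !monalg.mcoeffU mulr_natr.
by rewrite clifford_projZ; apply: Pl => //; case: m.
Qed.

End CliffordGenerators.

Lemma radical_form_nondeg (F : fieldType) m (G : 'M[F]_m) (u : radical_quot G) :
  G^T = G -> (forall v, radical_form u v = 0) -> u = 0.
Proof.
move=> symG u0; rewrite -[u]radical_reprK -[0](linear0 (@radical_proj F m G)).
apply/radical_proj_eq; rewrite mul0mx; apply/eqP; rewrite -radicalE.
apply/asboolP=> v; rewrite -(radical_form_proj symG) radical_reprK; exact: u0.
Qed.

Lemma sqr_quotient (F : fieldType) (x a t : F) :
  t ^+ 2 != 0 -> t ^+ 2 * x = a ^+ 2 -> x = (a / t) ^+ 2.
Proof. by move=> t0 tx; rewrite expr_div_n -tx mulrC mulKf. Qed.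

Section OddQuotient.
Variables (R : realType) (g : lieSuperalgebra R[i]) (q : prime_idealr (sym_alg g)).
Notation F := (frac_q q).
Notation V := (odd_quot q).

Let symG := bracket_mx_sym q.
Let symB (u v : V) : form_q u v = form_q v u.
Proof. exact: radical_formC. Qed.
Let linB (u : V) : linear (form_q u : V -> F^o).
Proof. exact: radical_form_linear. Qed.
Let ndB (u : V) : (forall v, form_q u v = 0) -> u = 0.
Proof. exact: radical_form_nondeg. Qed.

Lemma gram_det_neq0 n (e : n.-tuple V) : basis_of fullv e -> \det (gram e) != 0.
Proof. exact: gram_mx_det_neq0. Qed.

Lemma rank_qE : rank_q q = \dim {:V}.
Proof.
apply: mxrank_unit; rewrite unitmxE unitfE; apply: gram_det_neq0.
exact: vbasisP.
Qed.

Lemma frac_q_sqr (c : R[i]) : exists a : F, a ^+ 2 = to_frac_q q (mpolyC _ c).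
Proof.
have [b <-] : exists b : R[i], b ^+ 2 = c by eexists; exact: Num.Theory.sqrtCK.
exists (to_frac_q q (mpolyC _ b)).
by rewrite rmorphXn (rmorphXn (to_frac_q q)).
Qed.

Lemma frac_q_sqrtN1 : exists a : F, a ^+ 2 = -1.
Proof.
have [a aE] := frac_q_sqr (-1); exists a.
by rewrite aE rmorphN1 (rmorphN1 (to_frac_q q)).
Qed.

Lemma frac_q_sqrt2 : exists a : F, a ^+ 2 = 2%:R.
Proof.
have [a aE] := frac_q_sqr 2%:R; exists a.
by rewrite aE rmorph_nat (rmorph_nat (to_frac_q q)).
Qed.

(** Lifting [e] to row vectors writes its Gram matrix as u G u^T with G the bracket matrix, so its
    determinant is a square times a principal minor of G. That minor is nonzero by nondegeneracy,
    and it is the class of a determinant of linear forms, of degree the dimension of the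
    quotient. *)
Lemma gram_nonsquare (e : (\dim {:V}).-tuple V) : homogeneous_ideal q ->
  basis_of fullv e -> odd (\dim {:V}) -> forall a, \det (gram e) <> a ^+ 2.
Proof.
move=> homq be oddn a.
have rkG : \rank (bracket_mx q) = \dim {:V} by rewrite dimvf.
have [h hE] := sym_mx_principal_minor symG rkG.
pose u := \matrix_(i < \dim {:V}) radical_repr (e`_i : V).
have gramE : gram e = u *m bracket_mx q *m u^T.
  apply/matrixP=> i j; rewrite mxE -[LHS]/((_ *m _ *m _) 0 0).
  have rowE (k : 'I_(\dim {:V})) : radical_repr (e`_k : V) = row k u.
    by rewrite rowK.
  by rewrite !rowE -row_mul tr_row -row_mul; rewrite !mxE; apply: eq_bigr => l _; rewrite !mxE.
have [t tE] := hE u; rewrite -gramE in tE.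
pose M : 'M[sym_alg g]_(\dim {:V}) := \matrix_(i, j)
  sym_inj (lsa_bracket (vbasis (odd_part g))`_(h i) (vbasis (odd_part g))`_(h j)).
have minorE : mxsub h h (bracket_mx q) = map_mx (to_frac_q q) M.
  by apply/matrixP=> i j; rewrite !mxE.
rewrite minorE (det_map_mx (to_frac_q q)) in tE.
have := gram_det_neq0 be; rewrite tE mulf_eq0 negb_or => /andP[t0].
rewrite to_frac_q_eq0 => Mq ta.
have detM : to_frac_q q (\det M) = (a / t) ^+ 2.
  exact: (sqr_quotient t0 ta).
apply: (homogeneous_odd_nonsquare homq oddn Mq _ detM).
by apply: graded_proj_det => i j; rewrite mxE; apply: graded_proj_linear.
Qed.
Lemma clifford_q_structure (e : (\dim {:V}).-tuple V) :
    homogeneous_ideal q -> basis_of fullv e ->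
  exists z : clifford_q q,
  [/\ has_dim (clifford_q q) (2 ^ \dim {:V}), simple_ring (clifford_q q),
      odd (\dim {:V}) ->
        z * z = (\det (gram e))%:A /\ forall y, z * y = y * z &
      forall x : clifford_q q, (forall y, x * y = y * x) ->
        exists u v, x = u%:A + v *: z /\ (odd (\dim {:V}) \/ v = 0)].
Proof.
move=> homq be.
pose iota : V -> clifford_q q := clifford_gen (@form_q R g q).
have iota_lin : linear iota by exact: clifford_gen_linear.
pose iota' : {linear V -> clifford_q q} :=
  HB.pack iota (GRing.isLinear.Build F V (clifford_q q) _ iota iota_lin).
have [ii ii2] := frac_q_sqrtN1; have [s2 s22] := frac_q_sqrt2.
apply: (clifford_structure symB linB (iota := iota') _ _ (frac_q_two_neq0 q)
  ii2 s22 be (gram_det_neq0 be)).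
- exact: clifford_gen_anticomm.
- exact: clifford_gen_ind.
- exact: gram_nonsquare.
Qed.

End OddQuotient.

Theorem lemma2p1 (R : realType) (g : lieSuperalgebra R[i])
    (q : prime_idealr (sym_alg g)) (hq : homogeneous_ideal q)
    (L : lmodType (clifford_q q)) (hL : simple_module L) :
  (exists (a : nat) (D : algType (frac_q q)),
      division_ring D /\ matrix_iso (clifford_q q) (2 ^ a) D)
  /\
  (~~ odd (rank_q q) ->
    central_simple (in_alg (clifford_q q)) /\
    exists n : nat,
      has_dim (restrict_scalars (in_alg (clifford_q q)) L) n /\
      (2 ^ (rank_q q)./2 <= n)%N /\
      forall (a : nat) (D : algType (frac_q q)),
        division_ring D -> matrix_iso (clifford_q q) (2 ^ a) D ->
        (n = (2 ^ (rank_q q)./2)%N <-> alg_iso (frac_q q)^o D))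
  /\
  (odd (rank_q q) ->
    (forall (e : (\dim {:odd_quot q}).-tuple (odd_quot q)) (K : fieldExtType (frac_q q)),
        basis_of fullv e -> adjoins_sqrt (\det (gram e)) K ->
        exists f : {lrmorphism K -> clifford_q q}, central_simple f) /\
    exists n : nat,
      has_dim (restrict_scalars (in_alg (clifford_q q)) L) n /\
      (2 ^ (rank_q q).+1./2 <= n)%N /\
      forall (a : nat) (D : algType (frac_q q)),
        division_ring D -> matrix_iso (clifford_q q) (2 ^ a) D ->
        forall (e : (\dim {:odd_quot q}).-tuple (odd_quot q))
               (K : fieldExtType (frac_q q)),
          basis_of fullv e -> adjoins_sqrt (\det (gram e)) K ->
          (n = (2 ^ (rank_q q).+1./2)%N <-> alg_iso K D)).
Proof.
have [z0 [dA simpleA _ cA]] := clifford_q_structure hq (vbasisP {:odd_quot q}).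
rewrite rank_qE; split; first exact: wedderburn_pow2 dA simpleA.
split=> [evk|oddk].
  split; last exact: simple_module_even.
  apply: central_simple_in_alg dA simpleA _ => x /cA[u [v [-> [oddk|->]]]].
    by rewrite oddk in evk.
  by exists u; rewrite scale0r addr0.
split=> [e K be adjK|].
  (* The structure result is applied anew to the given basis, since the square of z must be its Gram
     determinant. *)
  have [z [_ _ /(_ oddk)[zz cz] cA']] := clifford_q_structure hq be.
  apply: (quadratic_center dA simpleA zz cz) adjK _.
    exact: gram_nonsquare hq be oddk.
  by move=> x /cA'[u [v [-> _]]]; exists u, v.
have [n [dL [le_n nE]]] := simple_module_odd dA simpleA hL oddk.
exists n; split=> //; split=> // a D divD isoD e K be adjK.
have [d dD ->] := nE a D divD isoD.
have [z [_ _ /(_ oddk)[zz cz] _]] := clifford_q_structure hq be.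
exact: (quadratic_center_iso zz cz (gram_nonsquare hq be oddk) adjK isoD dD).
Qed.
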